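(* $\mathcal G_{\mathrm{tight}}$ is an étale groupoid, i.e. a locally compact groupoid whose range map is a local homeomorphism.
   Context: $\mathbb N=\{0,1,2,\dots\}$. $S$ is the left shift on $\ell^2(\mathbb N)$ ($Se_0=0$, $Se_n=e_{n-1}$), $p$ is the rank-one projection onto $\mathbb Ce_0$, and $\bm t$ is the left shift on $\ell^2(\mathbb Z)$ ($\bm te_n=e_{n-1}$). The inverse semigroup $T$ of operators on $\ell^2(\mathbb N)\otimes\ell^2(\mathbb N)\otimes\ell^2(\mathbb Z)$: for $\bm n=(n_1,n_2),\bm m=(m_1,m_2)\in\mathbb N^2$, $r\in\mathbb Z$, let $B_1(r,\bm n,\bm m)=S^{*n_1}S^{m_1}\otimes S^{*n_1}S^{m_1}\otimes\bm t^r$ for $n_1=n_2$, $m_1=m_2$, $r=m_1-n_1$; $B_2(r,\bm n,\bm m)=S^{*n_1}S^{m_1}\otimes S^{*n_2}pS^{m_2}\otimes\bm t^r$ for $r=m_1-n_1$, $n_1\ge n_2$, $m_1\ge m_2$; $B_3(r,\bm n,\bm m)=S^{*n_1}pS^{m_1}\otimes S^{*n_2}S^{m_2}\otimes\bm t^r$ for $r=m_2-n_2$, $n_1\le n_2$, $m_1\le m_2$; $B_4(r,\bm n,\bm m)=S^{*n_1}pS^{m_1}\otimes S^{*n_2}pS^{m_2}\otimes\bm t^r$ for any $r\in\mathbb Z$. $T$ is the set of all these operators together with $0$, an inverse semigroup under operator product and adjoint. $E$ is its commutative semigroup of projections, ordered by $e\le f\iff fe=e$. $\widehat E_0$ is the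 set of nonzero semigroup homomorphisms $x:E\to\{0,1\}$ with $x(0)=0$, with the subspace topology from $\{0,1\}^E$. A filter is a nonempty $A\subseteq E\setminus\{0\}$ that is upward closed and closed under products; ultrafilters are maximal filters. $\widehat E_\infty=\{x\in\widehat E_0:x^{-1}(1)\text{ is an ultrafilter}\}$ and $\widehat E_{\mathrm{tight}}$ is its closure in $\widehat E_0$. For $s\in T$ let $D_s=\{x\in\widehat E_0:x(ss^* )=1\}$, and for $x\in D_s$ let $(x\cdot s)(e)=x(ses^* )$. Let $\Sigma=\{(x,s):s\in T,\ x\in D_s\}$, with $(x,s)\sim(y,s')$ iff $x=y$ and $es=es'$ for some $e\in E$ with $x(e)=1$. $\mathcal G'=\Sigma/\sim$ is a groupoid with $[(x,s)][(x\cdot s,s')]=[(x,ss')]$, $[(x,s)]^{-1}=[(x\cdot s,s^* )]$, topologized by the basis $\Theta(U,s)=\{[(x,s)]:x\in U\}$, $s\in T$, $U\subseteq D_s$ open; its unit space is $\widehat E_0$ via $[(x,1)]\leftrightarrow x$, so $[(x,s)]$ has range $x$ and source $x\cdot s$. $\mathcal G_{\mathrm{tight}}$ is the reduction of $\mathcal G'$ to $\widehat E_{\mathrm{tight}}$ (elements with range and source in $\widehat E_{\mathrm{tight}}$), with the subspace topology. *)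

(* Defs.v *)
From HB Require Import structures.
From mathcomp Require Import all_boot all_order all_algebra.
From mathcomp Require Import generic_quotient finmap.
From mathcomp Require Import all_classical all_reals.
From mathcomp Require Import topology normedtype esum.
From mathcomp.real_closed Require Import complex.
From mathcomp.analysis.showcase Require summability.
From mathcomp Require Import zify.

Set Implicit Arguments.
Unset Strict Implicit.
Unset Printing Implicit Defensive.

Import Order.TTheory GRing.Theory Num.Theory.
Import numFieldNormedType.Exports.

Local Open Scope classical_set_scope.
Local Open Scope quotient_scope.

(* [ivs_projC], together with the other laws, is equivalent to the uniqueness
   of generalized inverses. *)
Record inv_semigroup := InvSemigroup {
  ivs_car :> choiceType;
  ivs_mul : ivs_car -> ivs_car -> ivs_car;
  ivs_star : ivs_car -> ivs_car;
  ivs_zero : ivs_car;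
  ivs_one : ivs_car;
  ivs_mulA : forall s t u, ivs_mul s (ivs_mul t u) = ivs_mul (ivs_mul s t) u;
  ivs_mul1l : forall s, ivs_mul ivs_one s = s;
  ivs_mul1r : forall s, ivs_mul s ivs_one = s;
  ivs_mul0l : forall s, ivs_mul ivs_zero s = ivs_zero;
  ivs_mul0r : forall s, ivs_mul s ivs_zero = ivs_zero;
  ivs_starK : forall s, ivs_star (ivs_star s) = s;
  ivs_starM : forall s t,
    ivs_star (ivs_mul s t) = ivs_mul (ivs_star t) (ivs_star s);
  ivs_regular : forall s, ivs_mul (ivs_mul s (ivs_star s)) s = s;
  ivs_projC : forall e f, ivs_mul e e = e -> ivs_star e = e ->
    ivs_mul f f = f -> ivs_star f = f -> ivs_mul e f = ivs_mul f e
}.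

Declare Scope ivs_scope.
Delimit Scope ivs_scope with ivs.
Local Open Scope ivs_scope.
Notation "s * t" := (ivs_mul s t) : ivs_scope.
Notation "s ^*" := (ivs_star s) : ivs_scope.
Notation "0" := (ivs_zero _) : ivs_scope.
Notation "1" := (ivs_one _) : ivs_scope.

Section Projections.
Variable T : inv_semigroup.
Implicit Types s t : T.

Definition is_proj : set T := [set e | e * e = e /\ e^* = e].

Lemma proj_idem e : is_proj e -> e * e = e. Proof. by case. Qed.
Lemma proj_star e : is_proj e -> e^* = e. Proof. by case. Qed.
Lemma projC e f : is_proj e -> is_proj f -> e * f = f * e.
Proof. by move=> [? ?] [? ?]; exact: ivs_projC. Qed.

Lemma star0 : (0 : T)^* = 0.
Proof.
by have := ivs_starM (0 : T)^* 0; rewrite ivs_mul0r ivs_starK ivs_mul0r.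
Qed.

Lemma star1 : (1 : T)^* = 1.
Proof.
by have := ivs_starM (1 : T)^* 1; rewrite ivs_mul1r ivs_starK ivs_mul1r.
Qed.

Lemma proj_zero : is_proj (0 : T).
Proof. by split; [exact: ivs_mul0r | exact: star0]. Qed.

Lemma proj_one : is_proj (1 : T).
Proof. by split; [exact: ivs_mul1r | exact: star1]. Qed.

Lemma projM e f : is_proj e -> is_proj f -> is_proj (e * f).
Proof.
move=> He Hf; split.
  rewrite ivs_mulA -[e * f * e]ivs_mulA (projC Hf He) ivs_mulA.
  by rewrite (proj_idem He) -ivs_mulA (proj_idem Hf).
by rewrite ivs_starM (proj_star He) (proj_star Hf) projC.
Qed.

Lemma proj_mulstar s : is_proj (s * s^*).
Proof.
by split; [rewrite ivs_mulA ivs_regular | rewrite ivs_starM ivs_starK].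
Qed.

Lemma proj_starmul s : is_proj (s^* * s).
Proof. by rewrite -{2}(ivs_starK s); exact: proj_mulstar. Qed.

Lemma regularV s : s^* * s * s^* = s^*.
Proof. by rewrite -{2}(ivs_starK s) ivs_regular. Qed.

Lemma conjM s e f : is_proj e -> is_proj f ->
  (s * e * s^*) * (s * f * s^*) = s * (e * f) * s^*.
Proof.
move=> He Hf.
rewrite !ivs_mulA -[s * e * s^* * s]ivs_mulA -[s * e * (s^* * s)]ivs_mulA.
rewrite (projC He (proj_starmul s)) !ivs_mulA; congr (_ * _ * _ * _).
exact: ivs_regular.
Qed.

Lemma proj_conj s e : is_proj e -> is_proj (s * e * s^*).
Proof.
move=> He; split; first by rewrite conjM// (proj_idem He).
by rewrite !ivs_starM ivs_starK (proj_star He) ivs_mulA.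
Qed.

Lemma conj_germ e f s t : is_proj e -> is_proj f -> e * s = e * t ->
  e * (s * f * s^*) = e * (t * f * t^*).
Proof.
move=> He Hf es.
suff H u : e * (u * f * u^*) = (e * u) * f * (e * u)^* by rewrite H es -H.
rewrite ivs_starM (proj_star He) -{1}(proj_idem He) -ivs_mulA.
by rewrite (projC He (proj_conj u Hf)) !ivs_mulA.
Qed.

Lemma conj_mul s t f : is_proj f -> s * f * s^* * (s * t) = s * (f * t).
Proof.
move=> Hf; rewrite -[LHS]ivs_mulA [s^* * _]ivs_mulA -[LHS]ivs_mulA.
rewrite [f * _]ivs_mulA (projC Hf (proj_starmul s)) !ivs_mulA.
by rewrite ivs_regular.
Qed.

End Projections.

Section ProjectionType.
Variable T : inv_semigroup.

Definition E : choiceType := set_type (@is_proj T).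

Definition mkE (e : T) (He : is_proj e) : E := exist _ e (mem_set He).

Lemma E_proj (e : E) : is_proj (val e). Proof. exact: set_valP. Qed.

Definition E_zero : E := mkE (proj_zero T).
Definition E_one : E := mkE (proj_one T).
Definition E_mul (e f : E) : E := mkE (projM (E_proj e) (E_proj f)).
Definition E_ran (s : T) : E := mkE (proj_mulstar s).
Definition E_conj (s : T) (e : E) : E := mkE (proj_conj s (E_proj e)).

Definition E_le (e f : E) : Prop := E_mul f e = e.

End ProjectionType.

Arguments E_zero {T}.
Arguments E_one {T}.

Section Spectrum.
Variable T : inv_semigroup.
Local Notation E := (E T).

Definition cube : topologicalType := prod_topology (fun _ : E => bool).

Definition characters : set cube := [set x |
  [/\ exists e, x e = true,
      forall e f, x (E_mul e f) = x e && x f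
    & x E_zero = false]].

Definition Ehat0 : topologicalType := set_type characters.

Definition ch (x : Ehat0) : E -> bool := val x.

Definition is_filter (A : set E) : Prop :=
  [/\ A !=set0, ~ A E_zero,
      forall e f, A e -> E_le e f -> A f
    & forall e f, A e -> A f -> A (E_mul e f)].

Definition is_ultrafilter (A : set E) : Prop :=
  is_filter A /\ forall B, is_filter B -> A `<=` B -> B = A.

Definition Ehat_infty : set Ehat0 :=
  [set x | is_ultrafilter [set e | ch x e = true]].

Definition Ehat_tight : set Ehat0 := closure Ehat_infty.

Definition dom (s : T) : set Ehat0 := [set x | ch x (E_ran s) = true].

Lemma chM (x : Ehat0) e f : ch x (E_mul e f) = ch x e && ch x f.
Proof. by have [_ + _] := set_valP x; exact. Qed.

Lemma ch0 (x : Ehat0) : ch x E_zero = false.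
Proof. by have [] := set_valP x. Qed.

Lemma ch1 (x : Ehat0) : ch x E_one = true.
Proof.
have [[e xe] _ _] := set_valP x.
suff : ch x (E_mul E_one e) = true by rewrite chM => /andP[].
rewrite -xe; congr (ch x _); apply: val_inj; exact: ivs_mul1l.
Qed.

Lemma Ehat0_eq (x y : Ehat0) : ch x =1 ch y -> x = y.
Proof. by move=> xy; apply: val_inj; apply: funext. Qed.

Definition act_fun (x : Ehat0) (s : T) : cube := fun e => ch x (E_conj s e).

Lemma act_subproof (x : Ehat0) (s : T) : dom s x -> characters (act_fun x s).
Proof.
move=> xs; split.
- exists (mkE (proj_starmul s)); rewrite /act_fun -[RHS]xs; congr (ch x _).
  by apply: val_inj => /=; rewrite ivs_mulA ivs_regular.
- move=> e f; rewrite /act_fun -chM; congr (ch x _).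
  by apply: val_inj => /=; rewrite conjM//; exact: E_proj.
- rewrite /act_fun -[RHS](ch0 x); congr (ch x _).
  by apply: val_inj => /=; rewrite ivs_mul0r ivs_mul0l.
Qed.

Definition act (x : Ehat0) (s : T) (xs : dom s x) : Ehat0 :=
  exist _ (act_fun x s) (mem_set (act_subproof xs)).

End Spectrum.

(* The multiplication is a total function whose value is meaningful only on
   composable pairs, i.e. when [src g = rng h].  No compatibility with the two
   topologies is required here. *)
Record groupoid := Groupoid {
  arr : topologicalType;
  obj : topologicalType;
  rng : arr -> obj;
  src : arr -> obj;
  idt : obj -> arr;
  gmul : arr -> arr -> arr;
  ginv : arr -> arr;
  rng_idt : forall x, rng (idt x) = x;
  src_idt : forall x, src (idt x) = x;
  rng_mul : forall g h, src g = rng h -> rng (gmul g h) = rng g;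
  src_mul : forall g h, src g = rng h -> src (gmul g h) = src h;
  gmulA : forall g h k, src g = rng h -> src h = rng k ->
    gmul g (gmul h k) = gmul (gmul g h) k;
  gmul_idl : forall g, gmul (idt (rng g)) g = g;
  gmul_idr : forall g, gmul g (idt (src g)) = g;
  rng_inv : forall g, rng (ginv g) = src g;
  src_inv : forall g, src (ginv g) = rng g;
  gmul_invr : forall g, gmul g (ginv g) = idt (rng g);
  gmul_invl : forall g, gmul (ginv g) g = idt (src g)
}.

Definition is_topological_groupoid (G : groupoid) : Prop :=
  [/\ continuous (@rng G),
      continuous (@src G),
      continuous (@idt G),
      continuous (@ginv G)
    & {within [set gh : arr G * arr G | src gh.1 = rng gh.2],
        continuous (fun gh => gmul gh.1 gh.2)}].

(* "locally compact" is understood to include the Hausdorff property *)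
Definition is_locally_compact_groupoid (G : groupoid) : Prop :=
  [/\ is_topological_groupoid G,
      hausdorff_space (arr G)
    & locally_compact [set: arr G]].

Definition homeomorphism_on (X Y : topologicalType) (f : X -> Y) (U : set X) :=
  exists g : Y -> X,
    [/\ forall x, U x -> g (f x) = x,
        {within U, continuous f}
      & {within f @` U, continuous g}].

Definition local_homeomorphism (X Y : topologicalType) (f : X -> Y) : Prop :=
  forall x, exists U : set X,
    [/\ open U, U x, open (f @` U) & homeomorphism_on f U].

Definition is_etale (G : groupoid) : Prop :=
  is_locally_compact_groupoid G /\ local_homeomorphism (@rng G).

Section Reduction.
Variables (G : groupoid) (X : set (obj G)).

Definition red_arrows : set (arr G) := [set g | X (rng g) /\ X (src g)].

Definition red_arr : topologicalType := set_type red_arrows.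
Definition red_obj : topologicalType := set_type X.

Definition mk_arr g (Hg : red_arrows g) : red_arr := exist _ g (mem_set Hg).
Definition mk_obj x (Hx : X x) : red_obj := exist _ x (mem_set Hx).

Lemma red_arrP (g : red_arr) : red_arrows (val g). Proof. exact: set_valP. Qed.

Definition red_rng (g : red_arr) : red_obj := mk_obj (proj1 (red_arrP g)).
Definition red_src (g : red_arr) : red_obj := mk_obj (proj2 (red_arrP g)).

Lemma red_idt_subproof (x : red_obj) : red_arrows (idt (val x)).
Proof. by split; rewrite ?rng_idt ?src_idt; exact: set_valP. Qed.

Definition red_idt (x : red_obj) : red_arr := mk_arr (red_idt_subproof x).

Lemma red_inv_subproof (g : red_arr) : red_arrows (ginv (val g)).
Proof. by have [? ?] := red_arrP g; split; rewrite ?rng_inv ?src_inv. Qed.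

Definition red_inv (g : red_arr) : red_arr := mk_arr (red_inv_subproof g).

Lemma red_mul_subproof (g h : red_arr) :
  src (val g) = rng (val h) -> red_arrows (gmul (val g) (val h)).
Proof.
move=> gh; have [? ?] := red_arrP g; have [? ?] := red_arrP h.
by split; rewrite ?rng_mul ?src_mul.
Qed.

(* the value [g] on non-composable pairs is irrelevant *)
Definition red_mul (g h : red_arr) : red_arr :=
  if pselect (src (val g) = rng (val h)) is left gh
  then mk_arr (red_mul_subproof gh) else g.

Lemma open_red_arr (O : set red_arr) : open O <->
  exists2 O' : set (arr G), open O' & O = [set g | O' (val g)].
Proof. by split=> [[O' oO' <-]|[O' oO' ->]]; exists O'. Qed.

Lemma val_red_mul (g h : red_arr) : src (val g) = rng (val h) ->
  val (red_mul g h) = gmul (val g) (val h).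
Proof. by rewrite /red_mul; case: pselect. Qed.

Lemma red_composable (g h : red_arr) :
  red_src g = red_rng h -> src (val g) = rng (val h).
Proof. by move=> /(congr1 val). Qed.

Lemma red_rng_idt x : red_rng (red_idt x) = x.
Proof. by apply: val_inj; rewrite /= rng_idt. Qed.

Lemma red_src_idt x : red_src (red_idt x) = x.
Proof. by apply: val_inj; rewrite /= src_idt. Qed.

Lemma red_rng_mul g h : red_src g = red_rng h ->
  red_rng (red_mul g h) = red_rng g.
Proof.
move=> /red_composable gh; apply: val_inj.
by rewrite /= val_red_mul// rng_mul.
Qed.

Lemma red_src_mul g h : red_src g = red_rng h ->
  red_src (red_mul g h) = red_src h.
Proof.
move=> /red_composable gh; apply: val_inj.
by rewrite /= val_red_mul// src_mul.
Qed.

Lemma red_mulA g h k : red_src g = red_rng h -> red_src h = red_rng k ->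
  red_mul g (red_mul h k) = red_mul (red_mul g h) k.
Proof.
move=> /red_composable gh /red_composable hk; apply: val_inj.
have ghk : src (val g) = rng (val (red_mul h k)).
  by rewrite val_red_mul// rng_mul.
have gh_k : src (val (red_mul g h)) = rng (val k).
  by rewrite val_red_mul// src_mul.
by rewrite (val_red_mul ghk) (val_red_mul hk) (val_red_mul gh_k)
  (val_red_mul gh) gmulA.
Qed.

Lemma red_mul_idl g : red_mul (red_idt (red_rng g)) g = g.
Proof. by apply: val_inj; rewrite val_red_mul/= ?gmul_idl// src_idt. Qed.

Lemma red_mul_idr g : red_mul g (red_idt (red_src g)) = g.
Proof. by apply: val_inj; rewrite val_red_mul/= ?gmul_idr// rng_idt. Qed.

Lemma red_rng_inv g : red_rng (red_inv g) = red_src g.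
Proof. by apply: val_inj; rewrite /= rng_inv. Qed.

Lemma red_src_inv g : red_src (red_inv g) = red_rng g.
Proof. by apply: val_inj; rewrite /= src_inv. Qed.

Lemma red_mul_invr g : red_mul g (red_inv g) = red_idt (red_rng g).
Proof. by apply: val_inj; rewrite val_red_mul/= ?gmul_invr// rng_inv. Qed.

Lemma red_mul_invl g : red_mul (red_inv g) g = red_idt (red_src g).
Proof. by apply: val_inj; rewrite val_red_mul/= ?gmul_invl// src_inv. Qed.

Definition reduction : groupoid :=
  Groupoid red_rng_idt red_src_idt red_rng_mul red_src_mul red_mulA
    red_mul_idl red_mul_idr red_rng_inv red_src_inv red_mul_invr red_mul_invl.

End Reduction.

Section Germs.
Variable T : inv_semigroup.
Local Notation Ehat0 := (Ehat0 T).

Definition Sigma : choiceType :=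
  set_type [set xs : Ehat0 * T | dom xs.2 xs.1].

Definition pt (a : Sigma) : Ehat0 := (val a).1.
Definition elt (a : Sigma) : T := (val a).2.

Lemma SigmaP (a : Sigma) : dom (elt a) (pt a).
Proof. by case: a => xs xsP; exact: (set_mem xsP). Qed.

Definition mkS (x : Ehat0) (s : T) (xs : dom s x) : Sigma :=
  exist _ (x, s) (@mem_set _ [set xs : Ehat0 * T | dom xs.2 xs.1] (x, s) xs).

Definition target (a : Sigma) : Ehat0 := act (SigmaP a).

Definition sim (a b : Sigma) : bool :=
  `[< pt a = pt b /\
      exists e : E T, ch (pt a) e = true /\ val e * elt a = val e * elt b >].

Lemma sim_refl : reflexive sim.
Proof.
by move=> a; apply/asboolP; split=> //; exists E_one; split=> //; exact: ch1.
Qed.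

Lemma sim_sym : symmetric sim.
Proof.
suff H a b : sim a b -> sim b a by move=> a b; apply/idP/idP; exact: H.
move=> /asboolP[ab [e [ae es]]]; apply/asboolP; split => //.
by exists e; rewrite -ab.
Qed.

Lemma sim_trans : transitive sim.
Proof.
move=> b a c /asboolP[ab [e [ae es]]] /asboolP[bc [f [bf fs]]].
apply/asboolP; split; first by rewrite ab.
exists (E_mul e f); split; first by rewrite chM ae /= ab.
rewrite /= {1}(projC (E_proj e) (E_proj f)) -!ivs_mulA es -fs.
by rewrite !ivs_mulA (projC (E_proj e) (E_proj f)).
Qed.

Definition sim_equiv := EquivRel sim sim_refl sim_sym sim_trans.

Definition germ : Type := {eq_quot sim_equiv}.
HB.instance Definition _ := Choice.on germ.
HB.instance Definition _ := EqQuotient.on germ.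

Definition cl (a : Sigma) : germ := \pi_germ a.

Lemma clP (a b : Sigma) : cl a = cl b <->
  pt a = pt b /\
  exists e : E T, ch (pt a) e = true /\ val e * elt a = val e * elt b.
Proof.
split; first by move=> /eqmodP /asboolP.
by move=> H; apply/eqmodP/asboolP.
Qed.

Definition Theta (U : set Ehat0) (s : T) : set germ :=
  [set g | exists a : Sigma, [/\ U (pt a), elt a = s & g = cl a]].

Definition Theta_basis : set (set germ) :=
  [set B | exists (U : set Ehat0) (s : T),
     [/\ open U, U `<=` dom s & B = Theta U s]].

Lemma open_ch (e : E T) : open [set x : Ehat0 | ch x e = true].
Proof.
have -> : [set x : Ehat0 | ch x e = true] =
  (fun x : Ehat0 => ch x e) @^-1` [set true] by [].
apply: open_comp; last exact: discrete_open.
move=> x _.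
apply: (@continuous_comp Ehat0 (cube T) bool val (fun x : cube T => x e)).
  exact: initial_continuous.
exact: (@proj_continuous (E T) (fun _ => bool) e).
Qed.

Lemma open_dom (s : T) : open (@dom T s). Proof. exact: open_ch. Qed.

Lemma Theta_cover : \bigcup_(B in Theta_basis) B = setT.
Proof.
apply/seteqP; split=> // g _; have [a ->] : exists a, g = cl a.
  by exists (repr g); rewrite /cl reprK.
exists (Theta (dom (elt a)) (elt a)).
  by exists (dom (elt a)), (elt a); split=> //; exact: open_dom.
by exists a; split=> //; exact: SigmaP.
Qed.

Lemma Theta_join (B C : set germ) g : Theta_basis B -> Theta_basis C ->
  B g -> C g ->
  exists D, [/\ Theta_basis D, D g & D `<=` B `&` C].
Proof.
move=> [U [s [oU Us ->]]] [V [t [oV Vt ->]]].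
move=> [a [Ua as_ ->]] [b [Vb bt /clP[ab [e [ae es]]]]].
exists (Theta (U `&` V `&` [set x | ch x e = true]) s); split.
- exists (U `&` V `&` [set x | ch x e = true]), s; split=> //.
    by apply: openI; [exact: openI | exact: open_ch].
  by move=> x [[Ux _] _]; exact: Us.
- by exists a; split=> //; split=> //; split=> //; rewrite ab.
- move=> _ [c [[[Uc Vc] ce] cs ->]]; split; first by exists c.
  exists (mkS (Vt _ Vc)); split=> //; apply/clP; split=> //.
  by exists e; split=> //; rewrite cs -as_ es bt.
Qed.

HB.instance Definition _ :=
  @isBaseTopological.Build germ (set germ) Theta_basis id Theta_cover Theta_join.

Lemma open_germ (O : set germ) : open O <->
  exists2 D, D `<=` Theta_basis & O = \bigcup_(B in D) B.
Proof. by split=> [[D DB <-]|[D DB ->]]; exists D. Qed.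

Definition germ_rng (g : germ) : Ehat0 := pt (repr g).
Definition germ_src (g : germ) : Ehat0 := target (repr g).

Lemma germE (g : germ) : g = cl (repr g). Proof. by rewrite /cl reprK. Qed.

Lemma target_cl (a b : Sigma) : cl a = cl b -> target a = target b.
Proof.
move=> /clP[ab [e [ae es]]]; apply: Ehat0_eq => f.
rewrite /ch /= /act_fun -ab.
transitivity (ch (pt a) (E_mul e (E_conj (elt a) f))); first by rewrite chM ae.
transitivity (ch (pt a) (E_mul e (E_conj (elt b) f))); last by rewrite chM ae.
congr (ch _ _); apply: val_inj; apply: conj_germ es; exact: E_proj.
Qed.

Lemma germ_rng_cl (a : Sigma) : germ_rng (cl a) = pt a.
Proof. by have /clP[] := esym (germE (cl a)). Qed.

Lemma germ_src_cl (a : Sigma) : germ_src (cl a) = target a.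
Proof. exact: target_cl (esym (germE (cl a))). Qed.

Lemma dom1 (x : Ehat0) : dom 1 x.
Proof.
rewrite /dom /= -[RHS](ch1 x); congr (ch x _); apply: val_inj => /=.
by rewrite star1 ivs_mul1r.
Qed.

Definition germ_idt (x : Ehat0) : germ := cl (mkS (dom1 x)).

Lemma dom_star (a : Sigma) : dom (elt a)^* (target a).
Proof.
rewrite /dom /= /ch /= /act_fun /= -[RHS](SigmaP a); congr (ch _ _).
by apply: val_inj => /=; rewrite ivs_starK !ivs_mulA ivs_regular.
Qed.

Definition germ_inv (g : germ) : germ := cl (mkS (dom_star (repr g))).

Lemma dom_mul (a b : Sigma) : target a = pt b -> dom (elt a * elt b) (pt a).
Proof.
move=> ab; have := SigmaP b; rewrite -ab /dom /= => <-.
rewrite /ch /= /act_fun; congr (ch _ _); apply: val_inj => /=.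
by rewrite ivs_starM !ivs_mulA.
Qed.

(* the value [g] on non-composable pairs is irrelevant *)
Definition germ_mul (g h : germ) : germ :=
  if pselect (target (repr g) = pt (repr h)) is left gh
  then cl (mkS (dom_mul gh)) else g.

Lemma germ_mul_cl (a b : Sigma) (ab : target a = pt b) :
  germ_mul (cl a) (cl b) = cl (mkS (dom_mul ab)).
Proof.
have Ha := esym (germE (cl a)); have Hb := esym (germE (cl b)).
have rab : target (repr (cl a)) = pt (repr (cl b)).
  by rewrite (target_cl Ha) ab; have /clP[] := Hb.
rewrite /germ_mul; case: pselect => // {}rab.
have /clP[pa [e [xe es]]] := Ha; have /clP[pb [f [xf ft]]] := Hb.
set a' := repr (cl a) in rab pa e xe es *.
set b' := repr (cl b) in rab pb f xf ft *.
apply/clP; split => //=; exists (E_mul e (E_conj (elt a') f)); split.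
  by rewrite chM xe /=; move: xf; rewrite -rab.
rewrite /elt /= -/(elt a') -/(elt b') -/(elt a) -/(elt b).
rewrite -[LHS]ivs_mulA (conj_mul _ _ (E_proj f)) ft [LHS]ivs_mulA es.
rewrite (conj_germ (E_proj e) (E_proj f) es).
by rewrite -[RHS]ivs_mulA (conj_mul _ _ (E_proj f)) [RHS]ivs_mulA.
Qed.

Lemma germ_ind (P : germ -> Prop) : (forall a, P (cl a)) -> forall g, P g.
Proof. by move=> H g; rewrite (germE g). Qed.

Lemma target_mkS x s (xs : dom s x) : target (mkS xs) = act xs.
Proof. exact: Ehat0_eq. Qed.

Lemma target_mul (a b : Sigma) (ab : target a = pt b) :
  target (mkS (dom_mul ab)) = target b.
Proof.
apply: Ehat0_eq => f; rewrite /ch /= /act_fun -ab; congr (ch _ _).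
by apply: val_inj => /=; rewrite ivs_starM !ivs_mulA.
Qed.

Lemma target_inv (a : Sigma) : target (mkS (dom_star a)) = pt a.
Proof.
apply: Ehat0_eq => f.
change (ch (pt a) (E_conj (elt a) (E_conj (elt a)^* f)) = ch (pt a) f).
transitivity (ch (pt a) (E_mul (E_mul (E_ran (elt a)) f) (E_ran (elt a)))).
  congr (ch _ _); apply: val_inj => /=; rewrite ivs_starK.
  by rewrite !ivs_mulA.
by rewrite !chM (SigmaP a) /= andbT.
Qed.

Lemma target1 (x : Ehat0) : target (mkS (dom1 x)) = x.
Proof.
apply: Ehat0_eq => f; rewrite /ch /= /act_fun; congr (ch x _).
by apply: val_inj => /=; rewrite star1 ivs_mul1r ivs_mul1l.
Qed.

Lemma cl_eq (a b : Sigma) : pt a = pt b -> elt a = elt b -> cl a = cl b.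
Proof.
by move=> ab st; apply/clP; split=> //; exists E_one; rewrite ch1 st.
Qed.

Lemma germ_inv_cl (a : Sigma) : germ_inv (cl a) = cl (mkS (dom_star a)).
Proof.
have Ha := esym (germE (cl a)); rewrite /germ_inv.
set a' := repr (cl a) in Ha *.
have tt := target_cl Ha; have /clP[pa [e [xe es]]] := Ha.
apply/clP; split=> //.
have xe' : ch (target a') (E_conj (elt a')^* e) = true.
  have : ch (target (mkS (dom_star a'))) e = true by rewrite target_inv.
  by [].
have ue : ch (target a') (E_conj (elt a)^* e) = true.
  have : ch (target (mkS (dom_star a))) e = true by rewrite target_inv -pa.
  by rewrite tt.
exists (E_mul (E_conj (elt a')^* e) (E_conj (elt a)^* e)).
split; first by rewrite chM xe'.
rewrite /elt /= -/(elt a') -/(elt a) !ivs_starK.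
move: (elt a') (elt a) es => s t es; have He := E_proj e.
have Q u : u^* * val e * u * u^* = u^* * val e.
  rewrite -!ivs_mulA (projC He (proj_mulstar u)) !ivs_mulA.
  by rewrite regularV.
have V : s^* * val e = t^* * val e.
  by have := congr1 (@ivs_star T) es; rewrite !ivs_starM (proj_star He).
have W : t^* * val e * t = s^* * val e * s.
  by rewrite -V -ivs_mulA -es ivs_mulA.
have I : is_proj (s^* * val e * s).
  by rewrite -{2}(ivs_starK s); apply: proj_conj; exact: E_proj.
by rewrite W (proj_idem I) Q -W Q V.
Qed.

Lemma germ_rng_idt x : germ_rng (germ_idt x) = x.
Proof. by rewrite germ_rng_cl. Qed.

Lemma germ_src_idt x : germ_src (germ_idt x) = x.
Proof. by rewrite germ_src_cl target1. Qed.

Lemma germ_rng_mul g h : germ_src g = germ_rng h ->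
  germ_rng (germ_mul g h) = germ_rng g.
Proof.
elim/germ_ind: g => a; elim/germ_ind: h => b.
rewrite germ_src_cl germ_rng_cl => ab.
by rewrite (germ_mul_cl ab) !germ_rng_cl.
Qed.

Lemma germ_src_mul g h : germ_src g = germ_rng h ->
  germ_src (germ_mul g h) = germ_src h.
Proof.
elim/germ_ind: g => a; elim/germ_ind: h => b.
rewrite germ_src_cl germ_rng_cl => ab.
by rewrite (germ_mul_cl ab) !germ_src_cl target_mul.
Qed.

Lemma germ_mulA g h k : germ_src g = germ_rng h -> germ_src h = germ_rng k ->
  germ_mul g (germ_mul h k) = germ_mul (germ_mul g h) k.
Proof.
elim/germ_ind: g => a; elim/germ_ind: h => b; elim/germ_ind: k => c.
rewrite !germ_src_cl !germ_rng_cl => ab bc.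
have abc : target (mkS (dom_mul ab)) = pt c by rewrite target_mul.
rewrite (germ_mul_cl ab) (germ_mul_cl bc) (germ_mul_cl abc).
have abc' : target a = pt (mkS (dom_mul bc)) by [].
rewrite (germ_mul_cl abc'); apply: cl_eq => //; exact: ivs_mulA.
Qed.

Lemma germ_mul_idl g : germ_mul (germ_idt (germ_rng g)) g = g.
Proof.
elim/germ_ind: g => a; rewrite germ_rng_cl.
have H : target (mkS (dom1 (pt a))) = pt a by rewrite target1.
by rewrite (germ_mul_cl H); apply: cl_eq => //; exact: ivs_mul1l.
Qed.

Lemma germ_mul_idr g : germ_mul g (germ_idt (germ_src g)) = g.
Proof.
elim/germ_ind: g => a; rewrite germ_src_cl.
have H : target a = pt (mkS (dom1 (target a))) by [].
by rewrite (germ_mul_cl H); apply: cl_eq => //; exact: ivs_mul1r.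
Qed.

Lemma germ_rng_inv g : germ_rng (germ_inv g) = germ_src g.
Proof.
by elim/germ_ind: g => a; rewrite germ_inv_cl germ_rng_cl germ_src_cl.
Qed.

Lemma germ_src_inv g : germ_src (germ_inv g) = germ_rng g.
Proof.
elim/germ_ind: g => a.
by rewrite germ_inv_cl germ_rng_cl germ_src_cl target_inv.
Qed.

Lemma germ_mul_invr g : germ_mul g (germ_inv g) = germ_idt (germ_rng g).
Proof.
elim/germ_ind: g => a; rewrite germ_inv_cl germ_rng_cl.
have H : target a = pt (mkS (dom_star a)) by [].
rewrite (germ_mul_cl H); apply/clP; split=> //.
exists (E_ran (elt a)); split; first exact: SigmaP.
rewrite /elt /= -/(elt a) ivs_mul1r.
exact: proj_idem (proj_mulstar _).
Qed.

Lemma germ_mul_invl g : germ_mul (germ_inv g) g = germ_idt (germ_src g).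
Proof.
elim/germ_ind: g => a; rewrite germ_inv_cl germ_src_cl.
have H : target (mkS (dom_star a)) = pt a by rewrite target_inv.
rewrite (germ_mul_cl H); apply/clP; split=> //.
exists (E_ran (elt a)^*); split; first exact: dom_star.
rewrite /elt /= -/(elt a) ivs_mul1r ivs_starK.
exact: proj_idem (proj_starmul _).
Qed.

Definition germ_groupoid : groupoid :=
  @Groupoid germ Ehat0 germ_rng germ_src germ_idt germ_mul germ_inv
    germ_rng_idt germ_src_idt germ_rng_mul germ_src_mul germ_mulA
    germ_mul_idl germ_mul_idr germ_rng_inv germ_src_inv
    germ_mul_invr germ_mul_invl.

Definition tight_groupoid : groupoid :=
  @reduction germ_groupoid (@Ehat_tight T).

End Germs.

Local Close Scope ivs_scope.
Local Open Scope ring_scope.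

(* injectivity where [phi] is defined *)
Definition pinj (I J : Type) (phi : I -> option J) :=
  forall i i' j, phi i = Some j -> phi i' = Some j -> i = i'.

Definition pinv (I J : Type) (phi : I -> option J) (psi : J -> option I) :=
  forall i j, phi i = Some j <-> psi j = Some i.

Lemma pinvC (I J : Type) (phi : I -> option J) psi :
  pinv phi psi -> pinv psi phi.
Proof. by move=> H j i; split=> /H. Qed.

Lemma pinv_pinj (I J : Type) (phi : I -> option J) psi :
  pinv phi psi -> pinj phi.
Proof. by move=> H i i' j /H + /H; move=> -> []. Qed.

Section Hilbert.
Variable R : realType.
Local Notation C := (R[i]^o).

Section l2.
Variable I : choiceType.

Definition square_summable : set (I -> C) :=
  [set f | (\esum_(i in [set: I]) ((complex.Re `|f i|) ^+ 2)%:E < +oo)%E].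

Definition l2 : choiceType := set_type square_summable.

Definition to_l2 (f : I -> C) (Hf : square_summable f) : l2 :=
  exist _ f (mem_set Hf).

Definition coef (f : l2) : I -> C := val f.

Definition inner (f g : l2) : C :=
  summability.sum (fun i => coef f i * (coef g i)^* : C).

Definition op := (l2 -> l2)%type.

(* The Hilbert space adjoint; every bounded operator has exactly one. *)
Definition is_adjoint (A B : op) : Prop :=
  forall f g, inner (A f) g = inner f (B g).

Lemma l2_eq (f g : l2) : coef f =1 coef g -> f = g.
Proof. by move=> fg; apply: val_inj; apply: funext. Qed.

End l2.

Section Pullback.
Variables I J : choiceType.

Definition pullback_fun (phi : I -> option J) (f : J -> C) : I -> C :=
  fun i => oapp f 0 (phi i).

Lemma pullback_subproof (phi : I -> option J) (f : l2 J) :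
  pinj phi -> square_summable (pullback_fun phi (coef f)).
Proof.
move=> phi_inj; have := set_valP f; rewrite /square_summable /mkset.
apply: le_lt_trans.
pose D := [set i | phi i != None].
pose G (o : option J) : \bar R :=
  ((complex.Re `|oapp (coef f) 0 o|) ^+ 2)%:E.
have G0 o : (0 <= G o)%E by rewrite lee_fin sqr_ge0.
have GN : G None = 0%E by rewrite /G [oapp _ _ _]/= normr0 /= expr0n.
rewrite [leLHS](_ : _ = \esum_(i in D) G (phi i))%E; last first.
  rewrite esum_mkcond; apply: eq_esum => i _; rewrite /D.
  case: ifPn => // /negP; rewrite inE /= /pullback_fun.
  by case E: (phi i) => [j|] // _; rewrite -GN.
rewrite -(esum_image D phi G); last first.
  move=> i i'; rewrite !inE /D /=; case E: (phi i) => [j|] // _ _ E'.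
  exact: (phi_inj _ _ _ E (esym E')).
rewrite [leRHS](_ : _ = \esum_(j in [set: J]) G (Some j))%E; last first.
  by apply: eq_esum.
rewrite -(esum_image [set: J] Some G); last first.
  by move=> j j' _ _ [].
rewrite esum_mkcond [leRHS]esum_mkcond; apply: le_esum => o _.
case: o => [j|]; last by rewrite GN !if_same.
by rewrite [X in (_ <= X)%E]ifT; [case: ifP | apply/mem_set; exists j].
Qed.

Definition pullback (phi : I -> option J) (H : pinj phi) (f : l2 J) : l2 I :=
  to_l2 (pullback_subproof f H).

Lemma pullbackE (phi : I -> option J) (H : pinj phi) f i :
  coef (pullback H f) i = oapp (coef f) 0 (phi i).
Proof. by []. Qed.

End Pullback.

Lemma pinj_none (I J : Type) : pinj (fun _ : I => @None J).
Proof. by []. Qed.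

Lemma zero_subproof (I : choiceType) : square_summable (fun _ : I => 0 : C).
Proof.
rewrite /square_summable /mkset esum1 ?ltry// => i _.
by rewrite normr0 /= expr0n.
Qed.

Definition l2_zero (I : choiceType) : l2 I :=
  to_l2 (zero_subproof I).

Definition zero_op (I : choiceType) : op I := fun _ => l2_zero I.

(* [adj A] is the adjoint of [A] whenever there is one, see [adjE] *)
Definition adj (I : choiceType) (A : op I) : op I :=
  xget (@zero_op I) [set B | is_adjoint A B].

Section Delta.
Variable I : choiceType.

Lemma delta_subproof (j : I) :
  square_summable (fun i : I => if i == j then 1 else 0 : C).
Proof.
rewrite /square_summable /mkset.
rewrite [X in (X < _)%E](_ : _ = \esum_(i in [set j]) 1%:E)%E; last first.
  rewrite [RHS]esum_mkcond; apply: eq_esum => i _.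
  case: eqVneq => [->|ij]; first by rewrite mem_set// normr1 /= expr1n.
  rewrite memNset ?normr0 /= ?expr0n//; exact/eqP.
by rewrite esum_set1 ?ltry// lee_fin.
Qed.

Definition delta (j : I) : l2 I := to_l2 (delta_subproof j).

Lemma inner_delta (j : I) (g : l2 I) : inner (delta j) g = (coef g j)^*.
Proof.
have FF := @summability.totally_filter I.
rewrite /inner /summability.sum; apply: cvg_lim; first exact: norm_hausdorff.
apply: cvg_near_cst; exists [fset j]%fset => //= B jB.
have jB' : j \in B by apply: (fsubsetP jB); rewrite inE.
rewrite /summability.partial_sum.
rewrite (bigD1 [` jB']%fset) //= big1.
  by rewrite addr0 /coef /= eqxx mul1r.
move=> i ij; rewrite /coef /= ifN ?mul0r//.
Qed.

Lemma adjoint_unique (A B B' : op I) :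
  is_adjoint A B -> is_adjoint A B' -> B = B'.
Proof.
move=> AB AB'; apply: funext => g; apply: l2_eq => j.
by have := AB (delta j) g; rewrite AB' !inner_delta => /(can_inj conjCK).
Qed.

Lemma adjE (A B : op I) : is_adjoint A B -> adj A = B.
Proof.
move=> AB; rewrite /adj; case: xgetP => [B' _ AB'|/(_ B)//].
exact: adjoint_unique AB' AB.
Qed.

End Delta.

Section SumReindex.
Local Open Scope fset_scope.

Lemma partial_sumE (I : choiceType) (a : I -> C) (A : {fset I}) :
  summability.partial_sum a A = \sum_(i <- A) a i.
Proof. by rewrite /summability.partial_sum big_seq_fsetE. Qed.

Lemma sum_reindex_sub (I J : choiceType) (phi : I -> option J)
    (psi : J -> option I) (a : I -> C) (b : J -> C) : pinv phi psi ->
  (forall i, a i = oapp b 0 (phi i)) ->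
  (forall j, b j = oapp a 0 (psi j)) ->
  summability.partial_sum b @ summability.totally `=>`
  summability.partial_sum a @ summability.totally.
Proof.
move=> pp ab ba U [A _ AU].
have pinjJ := pinv_pinj (pinvC pp).
exists [fset j in pmap phi A] => // B /= AB.
pose Cs := A `|` [fset i in pmap psi B].
suff -> : summability.partial_sum b B = summability.partial_sum a Cs.
  by apply: AU; exact: fsubsetUl.
rewrite !partial_sumE.
have -> : \sum_(i <- Cs) a i = \sum_(j <- pmap phi Cs) b j.
  by rewrite big_pmap; apply: eq_bigr => i _; rewrite ab.
have -> : \sum_(j <- B) b j = \sum_(j <- B | psi j != None) b j.
  rewrite [RHS]big_mkcond; apply: eq_bigr => j _.
  by rewrite ba; case: (psi j).
rewrite -big_filter; apply: perm_big; apply: uniq_perm.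
- by rewrite filter_uniq// fset_uniq.
- have : uniq Cs by exact: fset_uniq.
  elim: (enum_fset Cs) => //= i s IH /andP[is_ us].
  case E: (phi i) => [j|] //=; last exact: IH.
  rewrite IH// andbT; apply: contra is_.
  rewrite mem_pmap => /mapP[i' i's E'].
  by rewrite (pinv_pinj pp E (esym E')).
- move=> j; rewrite mem_filter; apply/andP/idP.
    case=> + jB; case E: (psi j) => [i|] // _.
    have E' : phi i = Some j by apply/pp.
    rewrite mem_pmap; apply/mapP; exists i => //.
    rewrite in_fsetU !inE; apply/orP; right.
    by rewrite mem_pmap; apply/mapP; exists j.
  rewrite mem_pmap => /mapP[i iC E].
  have E' : psi j = Some i by apply/pp.
  split; first by rewrite E'.
  move: iC; rewrite in_fsetU => /orP[iA|].
    apply: (fsubsetP AB); rewrite inE mem_pmap.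
    by apply/mapP; exists i.
  rewrite inE mem_pmap => /mapP[j' j'B E''].
  by rewrite (pinjJ _ _ _ E' (esym E'')).
Qed.

Lemma sum_reindex (I J : choiceType) (phi : I -> option J)
    (psi : J -> option I) (a : I -> C) (b : J -> C) : pinv phi psi ->
  (forall i, a i = oapp b 0 (phi i)) ->
  (forall j, b j = oapp a 0 (psi j)) ->
  summability.sum a = summability.sum b.
Proof.
move=> pp ab ba; rewrite /summability.sum; congr (lim _).
apply/seteqP; split; first exact: (sum_reindex_sub pp ab ba).
exact: (sum_reindex_sub (pinvC pp) ba ab).
Qed.

End SumReindex.

Lemma pullback_adjoint (I : choiceType) (phi psi : I -> option I)
    (Hphi : pinj phi) (Hpsi : pinj psi) : pinv phi psi ->
  is_adjoint (pullback Hphi) (pullback Hpsi).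
Proof.
move=> pp f g; rewrite /inner; apply: (sum_reindex pp).
- move=> i; rewrite pullbackE; case E: (phi i) => [j|] /=; last by rewrite mul0r.
  by rewrite pullbackE; move/pp: E => ->.
- move=> j; rewrite [in LHS]pullbackE; case E: (psi j) => [i|] /=.
    by rewrite pullbackE; move/pp: E => ->.
  by rewrite conjC0 mulr0.
Qed.

Lemma adj_pullback (I : choiceType) (phi psi : I -> option I)
    (Hphi : pinj phi) (Hpsi : pinj psi) : pinv phi psi ->
  adj (pullback Hphi) = pullback Hpsi.
Proof. by move=> pp; apply: adjE; exact: pullback_adjoint. Qed.

Lemma pullback_inj (I : choiceType) (phi psi : I -> option I)
    (Hphi : pinj phi) (Hpsi : pinj psi) :
  pullback Hphi = pullback Hpsi -> phi = psi.
Proof.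
move=> E; apply: funext => i.
have H j : coef (pullback Hphi (delta j)) i = coef (pullback Hpsi (delta j)) i.
  by rewrite E.
have K (o : option I) j : (oapp (coef (delta j)) 0 o == 1) = (o == Some j).
  case: o => [k|] /=; last by rewrite eq_sym oner_eq0.
  rewrite /coef /=; case: (eqVneq k j) => [->|kj]; first by rewrite !eqxx.
  by rewrite eq_sym oner_eq0; apply/esym/eqP => -[] /eqP; exact/negP.
case Ei : (phi i) => [j|].
  by apply/esym/eqP; rewrite -K -pullbackE -H pullbackE Ei K.
case Ei' : (psi i) => [j|] //.
by apply/eqP; rewrite -Ei -K -pullbackE H pullbackE Ei' K.
Qed.

Lemma pullback_ext (I J : choiceType) (phi psi : I -> option J)
    (Hphi : pinj phi) (Hpsi : pinj psi) :
  phi =1 psi -> pullback Hphi = pullback Hpsi.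
Proof.
move=> E; apply: funext => f; apply: l2_eq => i.
by rewrite !pullbackE E.
Qed.

Definition pcomp (I J K : Type) (phi : I -> option J) (psi : J -> option K) :=
  fun i => obind psi (phi i).

Lemma pinj_comp (I J K : Type) (phi : I -> option J) (psi : J -> option K) :
  pinj phi -> pinj psi -> pinj (pcomp phi psi).
Proof.
move=> Hphi Hpsi i i' k; rewrite /pcomp.
case E: (phi i) => [j|] //=; case E': (phi i') => [j'|] //= H H'.
by have jj' := Hpsi _ _ _ H H'; rewrite jj' in E; exact: Hphi E E'.
Qed.

Lemma pinv_comp (I J K : Type) (phi : I -> option J) (psi : J -> option K)
    phi' psi' : pinv phi phi' -> pinv psi psi' ->
  pinv (pcomp phi psi) (pcomp psi' phi').
Proof.
move=> H H' i k; rewrite /pcomp; split.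
  by case E: (phi i) => [j|] //= /H' -> /=; exact/H.
by case E: (psi' k) => [j|] //= /H -> /=; exact/H'.
Qed.

Lemma pullback_comp (I J K : choiceType) (phi : I -> option J)
    (psi : J -> option K) (Hphi : pinj phi) (Hpsi : pinj psi) :
  pullback Hphi \o pullback Hpsi = pullback (pinj_comp Hphi Hpsi).
Proof.
apply: funext => f; apply: l2_eq => i.
by rewrite /= !pullbackE /pcomp; case: (phi i).
Qed.

(* [l2 (I * J)] is the Hilbert tensor product of [l2 I] and [l2 J]: it is the
   Hilbert sum over [j : J] of the slices [f (_, j)], on each of which
   [A \otimes 1] acts as [A].  For a bounded operator [A] the result is always
   square-summable, so that the default value of [mk_l2] is never used. *)
Section Tensor.
Variables I J : choiceType.

Definition mk_l2 (K : choiceType) (f : K -> C) : l2 K :=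
  if pselect (square_summable f) is left H then to_l2 H else l2_zero K.

Definition slice1 (f : l2 (I * J)%type) (j : J) : l2 I :=
  mk_l2 (fun i => coef f (i, j)).

Definition slice2 (f : l2 (I * J)%type) (i : I) : l2 J :=
  mk_l2 (fun j => coef f (i, j)).

Definition tensor1 (A : op I) : op (I * J)%type :=
  fun f => mk_l2 (fun ij => coef (A (slice1 f ij.2)) ij.1).

Definition tensor2 (B : op J) : op (I * J)%type :=
  fun f => mk_l2 (fun ij => coef (B (slice2 f ij.1)) ij.2).

Definition tensor (A : op I) (B : op J) : op (I * J)%type :=
  tensor1 A \o tensor2 B.

Lemma coef_mk_l2 (K : choiceType) (f : K -> C) :
  square_summable f -> coef (mk_l2 f) = f.
Proof. by rewrite /mk_l2; case: pselect. Qed.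

Lemma coef_slice1 f j i : coef (slice1 f j) i = coef f (i, j).
Proof.
have H : pinj (fun i : I => Some (i, j)) by move=> k k' ij [<-] [].
by rewrite /slice1 coef_mk_l2//; exact: (pullback_subproof f H).
Qed.

Lemma coef_slice2 f i j : coef (slice2 f i) j = coef f (i, j).
Proof.
have H : pinj (fun j : J => Some (i, j)) by move=> k k' ij [<-] [].
by rewrite /slice2 coef_mk_l2//; exact: (pullback_subproof f H).
Qed.

Definition ptensor (phi : I -> option I) (psi : J -> option J)
    (ij : I * J) : option (I * J) :=
  obind (fun i => omap (fun j => (i, j)) (psi ij.2)) (phi ij.1).

Lemma pinv_ptensor (phi phi' : I -> option I) (psi psi' : J -> option J) :
  pinv phi phi' -> pinv psi psi' -> pinv (ptensor phi psi) (ptensor phi' psi').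
Proof.
move=> H H' [i j] [k l]; rewrite /ptensor /=; split.
  case E: (phi i) => [k'|] //=; case E': (psi j) => [l'|] //= [<- <-].
  by move/H: E => -> /=; move/H': E' => -> /=.
case E: (phi' k) => [k'|] //=; case E': (psi' l) => [l'|] //= [<- <-].
by move/H: E => -> /=; move/H': E' => -> /=.
Qed.

Lemma pinj_ptensor (phi : I -> option I) (psi : J -> option J) :
  pinj phi -> pinj psi -> pinj (ptensor phi psi).
Proof.
move=> H H' [i j] [i' j'] [k l]; rewrite /ptensor /=.
case E1: (phi i) => [k1|] //=; case E2: (psi j) => [l1|] //= [? ?].
case E3: (phi i') => [k2|] //=; case E4: (psi j') => [l2|] //= [? ?].
by subst; rewrite (H _ _ _ E1 E3) (H' _ _ _ E2 E4).
Qed.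

Lemma tensor_pullback (phi : I -> option I) (psi : J -> option J)
    (Hphi : pinj phi) (Hpsi : pinj psi) :
  tensor (pullback Hphi) (pullback Hpsi) = pullback (pinj_ptensor Hphi Hpsi).
Proof.
have S1 : @pinj I I Some by move=> i i' j [->] [].
have S2 : @pinj J J Some by move=> i i' j [->] [].
apply: funext => f; rewrite /tensor /=.
have -> : tensor2 (pullback Hpsi) f = pullback (pinj_ptensor S1 Hpsi) f.
  apply: l2_eq => -[i j].
  have E : (fun ij => coef (pullback Hpsi (slice2 f ij.1)) ij.2) =
      coef (pullback (pinj_ptensor S1 Hpsi) f).
    apply: funext => -[i' j'] /=; rewrite !pullbackE /ptensor /=.
    by case: (psi j') => [l|] //=; rewrite coef_slice2.
  by rewrite /tensor2 E coef_mk_l2//; exact: set_valP.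
set h := pullback _ f.
have -> : tensor1 (pullback Hphi) h = pullback (pinj_ptensor Hphi S2) h.
  apply: l2_eq => -[i j].
  have E : (fun ij => coef (pullback Hphi (slice1 h ij.2)) ij.1) =
      coef (pullback (pinj_ptensor Hphi S2) h).
    apply: funext => -[i' j'] /=; rewrite !pullbackE /ptensor /=.
    by case: (phi i') => [l|] //=; rewrite coef_slice1.
  by rewrite /tensor1 E coef_mk_l2//; exact: set_valP.
apply: l2_eq => -[i j]; rewrite !pullbackE /ptensor /=.
by case: (phi i) => [k|] //=; rewrite pullbackE.
Qed.

End Tensor.

Lemma pinj_shift : pinj (fun n : nat => Some n.+1).
Proof. by move=> i i' j [<-] [->]. Qed.

Definition shiftS : op nat := pullback pinj_shift.

Lemma pinj_vacuum : pinj (fun n : nat => if n == 0%N then Some 0%N else None).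
Proof. by move=> [|i] [|i']. Qed.

Definition projp : op nat := pullback pinj_vacuum.

Lemma pinj_tshift (r : int) : pinj (fun k : int => Some (k + r)).
Proof. by move=> i i' j [<-] [] /addIr. Qed.

Definition tpow (r : int) : op int := pullback (@pinj_tshift r).

Lemma shiftS_delta0 : shiftS (delta 0%N) = l2_zero nat.
Proof. exact: l2_eq. Qed.

Lemma shiftS_deltaS n : shiftS (delta n.+1) = delta n.
Proof. exact: l2_eq. Qed.

Lemma projp_delta0 : projp (delta 0%N) = delta 0%N.
Proof. by apply: l2_eq => -[|k]. Qed.

Lemma projp_deltaS n : projp (delta n.+1) = l2_zero nat.
Proof. by apply: l2_eq => -[|k]. Qed.

Lemma tpow_delta r k : tpow r (delta k) = delta (k - r).
Proof.
by apply: l2_eq => i; rewrite /tpow pullbackE /coef /= eq_sym -subr_eq eq_sym.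
Qed.

Definition SnSm (n m : nat) : op nat :=
  fun f => iter n (adj shiftS) (iter m shiftS f).

Definition SnpSm (n m : nat) : op nat :=
  fun f => iter n (adj shiftS) (projp (iter m shiftS f)).

Definition basis3 := (nat * nat * int)%type.

Definition B1 (r : int) (n m : nat * nat) : op basis3 :=
  tensor (tensor (SnSm n.1 m.1) (SnSm n.1 m.1)) (tpow r).
Definition B2 (r : int) (n m : nat * nat) : op basis3 :=
  tensor (tensor (SnSm n.1 m.1) (SnpSm n.2 m.2)) (tpow r).
Definition B3 (r : int) (n m : nat * nat) : op basis3 :=
  tensor (tensor (SnpSm n.1 m.1) (SnSm n.2 m.2)) (tpow r).
Definition B4 (r : int) (n m : nat * nat) : op basis3 :=
  tensor (tensor (SnpSm n.1 m.1) (SnpSm n.2 m.2)) (tpow r).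

Inductive in_T : op basis3 -> Prop :=
| in_T0 : in_T (@zero_op basis3)
| in_T1 r (n m : nat * nat) : n.1 = n.2 -> m.1 = m.2 ->
    r = m.1%:Z - n.1%:Z -> in_T (B1 r n m)
| in_T2 r (n m : nat * nat) : r = m.1%:Z - n.1%:Z ->
    (n.1 >= n.2)%N -> (m.1 >= m.2)%N -> in_T (B2 r n m)
| in_T3 r (n m : nat * nat) : r = m.2%:Z - n.2%:Z ->
    (n.1 <= n.2)%N -> (m.1 <= m.2)%N -> in_T (B3 r n m)
| in_T4 r (n m : nat * nat) : in_T (B4 r n m).

Definition T_car : choiceType := set_type (in_T : set (op basis3)).

(* Every element of [T] is the pullback along a partial bijection of the
   canonical basis: [sig false n m] encodes [SnSm n m] and [sig true n m]
   encodes [SnpSm n m]. *)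
Definition sig (b : bool) (n m k : nat) : option nat :=
  if b then (if k == n then Some m else None)
  else (if (n <= k)%N then Some (k - n + m)%N else None).

Lemma sig_pinv b n m : pinv (sig b n m) (sig b m n).
Proof.
move=> i j; rewrite /sig; case: b.
  case: eqP => [->|ni]; case: eqP => [->|mj]; split=> // -[] E.
    by case: mj.
  by case: ni.
by case: ifP => ?; case: ifP => ?; split=> // -[] ?; try congr Some; lia.
Qed.

Lemma sig_pinj b n m : pinj (sig b n m).
Proof. exact: pinv_pinj (@sig_pinv b n m). Qed.

Lemma adj_shiftS :
  adj shiftS = pullback (@sig_pinj false 1 0).
Proof.
have -> : shiftS = pullback (@sig_pinj false 0 1).
  by apply: pullback_ext => k; rewrite /sig subn0 addn1.
exact/adj_pullback/sig_pinv.
Qed.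

Lemma iter_shiftS m f k : coef (iter m shiftS f) k = coef f (k + m)%N.
Proof.
elim: m k => [|m IH] k; first by rewrite addn0.
by rewrite iterS /shiftS pullbackE /= IH addSnnS.
Qed.

Lemma iter_adj_shiftS n f k : coef (iter n (adj shiftS) f) k =
  if (n <= k)%N then coef f (k - n)%N else 0.
Proof.
elim: n k => [|n IH] k; first by rewrite subn0.
rewrite iterS adj_shiftS pullbackE -adj_shiftS /sig.
case: k => [|k] //=; rewrite IH subn1 addn0 /= ltnS subSS.
by case: ifP.
Qed.

Lemma SnSmE n m : SnSm n m = pullback (@sig_pinj false n m).
Proof.
apply: funext => f; apply: l2_eq => k.
rewrite /SnSm iter_adj_shiftS pullbackE /sig; case: ifP => //= _.
by rewrite iter_shiftS.
Qed.

Lemma SnpSmE n m : SnpSm n m = pullback (@sig_pinj true n m).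
Proof.
apply: funext => f; apply: l2_eq => k.
rewrite /SnpSm iter_adj_shiftS pullbackE /sig /projp pullbackE.
case: (eqVneq k n) => [->|kn]; first by rewrite leqnn subnn /= iter_shiftS.
case: ifP => //= nk; case: ifP => //= kn0; exfalso; move: kn nk kn0; lia.
Qed.

Definition tsh (r k : int) : option int := Some (k + r).

Lemma tsh_pinv r : pinv (tsh r) (tsh (- r)).
Proof. by move=> i j; rewrite /tsh; split=> -[<-]; rewrite ?addrK ?addrNK. Qed.

Definition big b1 n1 m1 b2 n2 m2 r : basis3 -> option basis3 :=
  ptensor (ptensor (sig b1 n1 m1) (sig b2 n2 m2)) (tsh r).

Lemma big_pinv b1 n1 m1 b2 n2 m2 r :
  pinv (big b1 n1 m1 b2 n2 m2 r) (big b1 m1 n1 b2 m2 n2 (- r)).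
Proof.
by apply: pinv_ptensor; [apply: pinv_ptensor; exact: sig_pinv|exact: tsh_pinv].
Qed.

Lemma big_pinj b1 n1 m1 b2 n2 m2 r : pinj (big b1 n1 m1 b2 n2 m2 r).
Proof. exact: pinv_pinj (@big_pinv _ _ _ _ _ _ _). Qed.

Definition good (b1 : bool) (n1 m1 : nat) (b2 : bool) (n2 m2 : nat) (r : int) :=
  match b1, b2 with
  | false, false => [/\ n1 = n2, m1 = m2 & r = m1%:Z - n1%:Z]
  | false, true => [/\ r = m1%:Z - n1%:Z, (n1 >= n2)%N & (m1 >= m2)%N]
  | true, false => [/\ r = m2%:Z - n2%:Z, (n1 <= n2)%N & (m1 <= m2)%N]
  | true, true => True
  end.

Lemma tensor3E b1 n1 m1 b2 n2 m2 r :
  tensor (tensor (pullback (@sig_pinj b1 n1 m1)) (pullback (@sig_pinj b2 n2 m2)))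
    (tpow r) = pullback (@big_pinj b1 n1 m1 b2 n2 m2 r).
Proof. by rewrite /tpow !tensor_pullback; exact: pullback_ext. Qed.

Lemma zeroE : @zero_op basis3 = pullback (@pinj_none basis3 basis3).
Proof. by apply: funext => f; exact: l2_eq. Qed.

Lemma in_TP (A : op basis3) : in_T A <-> A = @zero_op basis3 \/
  exists b1 n1 m1 b2 n2 m2 r, good b1 n1 m1 b2 n2 m2 r /\
    A = pullback (@big_pinj b1 n1 m1 b2 n2 m2 r).
Proof.
split.
  case=> [|r [n1 n2] [m1 m2] /= <- <- rE|r [n1 n2] [m1 m2] /= ? ? ?
    |r [n1 n2] [m1 m2] /= ? ? ?|r [n1 n2] [m1 m2]]; [by left|right..].
  - exists false, n1, m1, false, n1, m1, r; split=> //.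
    by rewrite /B1 !SnSmE tensor3E.
  - exists false, n1, m1, true, n2, m2, r; split=> //.
    by rewrite /B2 SnSmE SnpSmE tensor3E.
  - exists true, n1, m1, false, n2, m2, r; split=> //.
    by rewrite /B3 SnSmE SnpSmE tensor3E.
  - exists true, n1, m1, true, n2, m2, r; split=> //.
    by rewrite /B4 !SnpSmE tensor3E.
move=> [->|]; first exact: in_T0.
move=> [b1 [n1 [m1 [b2 [n2 [m2 [r [g ->]]]]]]]]; move: g; rewrite -tensor3E.
case: b1; case: b2 => /=.
- by move=> _; rewrite -!SnpSmE; exact: (in_T4 r (n1, n2) (m1, m2)).
- move=> [? ? ?]; rewrite -SnpSmE -SnSmE.
  exact: (@in_T3 r (n1, n2) (m1, m2)).
- move=> [? ? ?]; rewrite -SnpSmE -SnSmE.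
  exact: (@in_T2 r (n1, n2) (m1, m2)).
- move=> [? ? ?]; subst n2 m2; rewrite -SnSmE.
  exact: (@in_T1 r (n1, n1) (m1, m1)).
Qed.

Lemma in_T_pinv (A : op basis3) : in_T A -> exists (phi psi : basis3 -> option basis3)
  (Hphi : pinj phi) (Hpsi : pinj psi),
  [/\ pinv phi psi, A = pullback Hphi & adj A = pullback Hpsi].
Proof.
move=> /in_TP[->|[b1 [n1 [m1 [b2 [n2 [m2 [r [g ->]]]]]]]]].
  exists (fun=> None), (fun=> None), (@pinj_none basis3 basis3), (@pinj_none basis3 basis3).
  by split=> //; rewrite zeroE //; exact: adj_pullback.
exists (big b1 n1 m1 b2 n2 m2 r), (big b1 m1 n1 b2 m2 n2 (- r)),
  (@big_pinj b1 n1 m1 b2 n2 m2 r), (@big_pinj b1 m1 n1 b2 m2 n2 (- r)).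
by split=> //; [|apply: adj_pullback]; exact: big_pinv.
Qed.

Lemma in_T_adj (A : op basis3) : in_T A -> in_T (adj A).
Proof.
move=> /in_TP[->|[b1 [n1 [m1 [b2 [n2 [m2 [r [g ->]]]]]]]]].
  rewrite zeroE (@adj_pullback _ _ _ _ (@pinj_none basis3 basis3))// -zeroE.
  exact: in_T0.
rewrite (adj_pullback _ (@big_pinj b1 m1 n1 b2 m2 n2 (- r))); last first.
  exact: big_pinv.
apply/in_TP; right; exists b1, m1, n1, b2, m2, n2, (- r); split=> //.
by move: g; case: b1; case: b2 => //= -[? ? ?]; split=> //; lia.
Qed.

Lemma is_adjoint_T (A : op basis3) : in_T A -> is_adjoint A (adj A).
Proof.
by move=> /in_T_pinv[phi [psi [? [? [? -> ->]]]]]; exact: pullback_adjoint.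
Qed.

(* the composite of two [sig]s is a [sig] or is nowhere defined *)
Definition sigM (b : bool) (n m : nat) (b' : bool) (n' m' : nat) :
    option (bool * nat * nat) :=
  match b, b' with
  | false, false => Some (false, n + (n' - m), m' + (m - n'))%N
  | false, true => if (m <= n')%N then Some (true, n + (n' - m), m')%N else None
  | true, false => if (n' <= m)%N then Some (true, n, m' + (m - n'))%N else None
  | true, true => if m == n' then Some (true, n, m') else None
  end.

Lemma sigME b n m b' n' m' k : pcomp (sig b n m) (sig b' n' m') k =
  if sigM b n m b' n' m' is Some (c, p, q) then sig c p q k else None.
Proof.
rewrite /pcomp /sigM /sig; case: b; case: b' => /=.
all: by repeat (case: ifP => //= ?); first [done | congr Some; lia | exfalso; lia].
Qed.

Lemma good_sigM b1 n1 m1 b2 n2 m2 r c1 p1 q1 c2 p2 q2 s d1 u1 v1 d2 u2 v2 :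
  good b1 n1 m1 b2 n2 m2 r -> good c1 p1 q1 c2 p2 q2 s ->
  sigM b1 n1 m1 c1 p1 q1 = Some (d1, u1, v1) ->
  sigM b2 n2 m2 c2 p2 q2 = Some (d2, u2, v2) ->
  good d1 u1 v1 d2 u2 v2 (r + s).
Proof.
case: b1; case: b2; case: c1; case: c2; rewrite /sigM;
  repeat (case: ifP => // ?); move=> g h [<- <- <-] [<- <- <-];
  move: g h => /=; try (by []);
  repeat (let x := fresh in case=> ? ? ? || move=> x);
  first [split; lia | lia].
Qed.

Lemma in_T_comp (A B : op basis3) : in_T A -> in_T B -> in_T (A \o B).
Proof.
move=> /in_TP[->|[b1 [n1 [m1 [b2 [n2 [m2 [r [g ->]]]]]]]]] HB.
  have -> : @zero_op basis3 \o B = @zero_op basis3 by [].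
  exact: in_T0.
move: HB => /in_TP[->|[c1 [p1 [q1 [c2 [p2 [q2 [s [h ->]]]]]]]]].
  have -> : pullback (@big_pinj b1 n1 m1 b2 n2 m2 r) \o @zero_op basis3 = @zero_op basis3.
    apply: funext => f; apply: l2_eq => k; rewrite /= pullbackE.
    by case: big.
  exact: in_T0.
rewrite pullback_comp; apply/in_TP.
have E : pcomp (big b1 n1 m1 b2 n2 m2 r) (big c1 p1 q1 c2 p2 q2 s) =1
    ptensor (ptensor (pcomp (sig b1 n1 m1) (sig c1 p1 q1))
                     (pcomp (sig b2 n2 m2) (sig c2 p2 q2))) (tsh (r + s)).
  move=> [[i j] k]; rewrite /pcomp /big /ptensor /=.
  case: (sig b1 n1 m1 i) => [i'|] //=; case: (sig b2 n2 m2 j) => [j'|] //=;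
    by case: (sig c1 p1 q1 i') => [i''|] //=; rewrite ?addrA.
case E1: (sigM b1 n1 m1 c1 p1 q1) => [[[d1 u1] v1]|]; last first.
  left; rewrite zeroE; apply: pullback_ext => -[[i j] k].
  by rewrite E /ptensor /= (sigME b1) E1.
case E2: (sigM b2 n2 m2 c2 p2 q2) => [[[d2 u2] v2]|]; last first.
  left; rewrite zeroE; apply: pullback_ext => -[[i j] k].
  by rewrite E /ptensor /= !sigME E1 E2; case: sig.
right; exists d1, u1, v1, d2, u2, v2, (r + s); split; last first.
  apply: pullback_ext => -[[i j] k].
  by rewrite E /big /ptensor /= !sigME E1 E2.
exact: good_sigM g h E1 E2.
Qed.

Lemma in_T_id : in_T id.
Proof.
apply/in_TP; right; exists false, 0%N, 0%N, false, 0%N, 0%N, 0; split=> //.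
apply: funext => f; apply: l2_eq => -[[i j] k].
by rewrite pullbackE /big /ptensor /sig /tsh /= !subn0 !addn0 addr0.
Qed.

Definition mkT (A : op basis3) (HA : in_T A) : T_car := exist _ A (mem_set HA).

Lemma T_P (s : T_car) : in_T (val s). Proof. by case: s => A HA; exact: (set_mem HA). Qed.

Definition T_mul (s t : T_car) : T_car := mkT (in_T_comp (T_P s) (T_P t)).
Definition T_star (s : T_car) : T_car := mkT (in_T_adj (T_P s)).
Definition T_zero : T_car := mkT in_T0.
Definition T_one : T_car := mkT in_T_id.

Lemma val_T_mul s t : val (T_mul s t) = val s \o val t. Proof. by []. Qed.
Lemma val_T_star s : val (T_star s) = adj (val s). Proof. by []. Qed.

Lemma T_mulA s t u : T_mul s (T_mul t u) = T_mul (T_mul s t) u.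
Proof. exact: val_inj. Qed.

Lemma T_mul1l s : T_mul T_one s = s. Proof. exact: val_inj. Qed.
Lemma T_mul1r s : T_mul s T_one = s. Proof. exact: val_inj. Qed.
Lemma T_mul0l s : T_mul T_zero s = T_zero. Proof. exact: val_inj. Qed.

Lemma T_mul0r s : T_mul s T_zero = T_zero.
Proof.
apply: val_inj; rewrite ?(val_T_mul, val_T_star).
have [phi [psi [Hp [Hq [_ -> _]]]]] := in_T_pinv (T_P s).
apply: funext => f; apply: l2_eq => i.
by rewrite /= pullbackE; case: (phi i).
Qed.

Lemma T_starK s : T_star (T_star s) = s.
Proof.
apply: val_inj; rewrite ?(val_T_mul, val_T_star).
have [phi [psi [Hp [Hq [pp -> ->]]]]] := in_T_pinv (T_P s).
exact/adj_pullback/pinvC.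
Qed.

Lemma T_starM s t : T_star (T_mul s t) = T_mul (T_star t) (T_star s).
Proof.
apply: val_inj; rewrite ?(val_T_mul, val_T_star).
have [phi [psi [Hp [Hq [pp -> ->]]]]] := in_T_pinv (T_P s).
have [phi' [psi' [Hp' [Hq' [pp' -> ->]]]]] := in_T_pinv (T_P t).
by rewrite !pullback_comp; apply: adj_pullback; exact: pinv_comp.
Qed.

Lemma T_regular s : T_mul (T_mul s (T_star s)) s = s.
Proof.
apply: val_inj; rewrite ?(val_T_mul, val_T_star).
have [phi [psi [Hp [Hq [pp -> ->]]]]] := in_T_pinv (T_P s).
rewrite !pullback_comp; apply: pullback_ext => i; rewrite /pcomp.
by case E: (phi i) => [j|] //=; move/pp: (E) => -> /=.
Qed.

Lemma T_proj_diag e : T_mul e e = e -> T_star e = e ->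
  exists phi (Hphi : pinj phi),
    val e = pullback Hphi /\ forall i j, phi i = Some j -> i = j.
Proof.
move=> /(congr1 val); rewrite val_T_mul => ee.
move=> /(congr1 val); rewrite val_T_star => es.
have [phi [psi [Hp [Hq [pp E E']]]]] := in_T_pinv (T_P e).
exists phi, Hp; split=> // i j ij.
have pq : psi = phi.
  by apply: (@pullback_inj _ _ _ Hq Hp); rewrite -E -E' es.
rewrite E pullback_comp in ee; move/pullback_inj/(congr1 (@^~ i)): ee.
rewrite /pcomp ij /=; move/pp: ij; rewrite pq => ->.
by case.
Qed.

Lemma T_projC e f : T_mul e e = e -> T_star e = e ->
  T_mul f f = f -> T_star f = f -> T_mul e f = T_mul f e.
Proof.
move=> ee es ff fs.
have [phi [Hp [Ep dp]]] := T_proj_diag ee es.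
have [psi [Hq [Eq dq]]] := T_proj_diag ff fs.
apply: val_inj; rewrite !val_T_mul Ep Eq !pullback_comp.
apply: pullback_ext => i; rewrite /pcomp.
case E: (phi i) => [j|] /=; case E': (psi i) => [k|] //=.
- by have ij := dp _ _ E; have ik := dq _ _ E'; subst j k; rewrite E E'.
- by have ij := dp _ _ E; subst j; rewrite E'.
- by have ik := dq _ _ E'; subst k; rewrite E.
Qed.

Definition T_semigroup : inv_semigroup :=
  InvSemigroup T_mulA T_mul1l T_mul1r T_mul0l T_mul0r T_starK T_starM
    T_regular T_projC.

End Hilbert.

Definition G_tight (R : realType) : groupoid := tight_groupoid (T_semigroup R).

(* Main.v *)
(** The semigroup T is E*-unitary: an element dominating a nonzero projection is
    a projection, because a partial bijection in T with one fixed point is a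
    partial identity.  Hence, if es = et with e nonzero below the ranges of s
    and t, then fs = ft for the largest possible f = ss* tt*; so the germs of s
    and t agree everywhere on the common domain or nowhere, which makes the
    groupoid of germs Hausdorff.  The spectrum is a closed, hence compact, part
    of the cube, and the tight spectrum is invariant since the partial action is
    continuous and preserves maximal characters.  The sections x |-> [(x, s)]
    over the compact open sets D_s then give both local compactness and the
    local inverses of the range map. *)
Require Import Defs.
From mathcomp Require Import all_boot all_order all_algebra.
From mathcomp Require Import all_classical all_reals topology.
From mathcomp Require Import zify.

Set Implicit Arguments.
Unset Strict Implicit.
Unset Printing Implicit Defensive.

Local Open Scope classical_set_scope.

(** * Initial topologies and subspaces *)

Section GeneralTopology.

Lemma cvg_initial (S : choiceType) (X : topologicalType) (w : S -> X)
    (F : set_system S) (s : S) : Filter F ->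
  w @ F --> w s -> F --> (s : initial_topology w).
Proof.
move=> FF Fw U [_ [[B oB <-] Bs BU]].
by apply: filterS BU _; apply: Fw; exact: open_nbhs_nbhs.
Qed.

Lemma continuous_set_val (X : topologicalType) (A : set X) :
  continuous (set_val : A -> X).
Proof. exact: initial_continuous. Qed.

Lemma continuous_into_set_type (X Y : topologicalType) (A : set X)
    (f : Y -> A) : continuous (set_val \o f) -> continuous f.
Proof. exact: continuous_comp_initial. Qed.

Lemma hausdorff_inj (X Y : topologicalType) (f : X -> Y) :
  continuous f -> injective f -> hausdorff_space Y -> hausdorff_space X.
Proof.
move=> fC fI hY p q pq; apply: fI; apply: hY => A B /fC Ap /fC Bq.
by have [x [Ax Bx]] := pq _ _ Ap Bq; exists (f x).
Qed.

(** A proper filter on the subtype pushes forward to one containing [A]; its cluster point lies in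
    [A], and basic neighbourhoods there are traces of open sets of [X]. *)
Lemma compact_set_type (X : topologicalType) (A : set X) :
  compact A -> compact [set: A].
Proof.
move=> cA F FF _.
have FA : (set_val @ F) A by apply: (@filterE _ F) => a; exact: set_valP.
have [x [Ax Fx]] := cA (set_val @ F) (fmap_proper_filter _ FF) FA.
exists (exist _ x (mem_set Ax)); split=> // B N FB [_ [[O oO <-] Ox ON]].
have FB' : (set_val @ F) (set_val @` B).
  by apply: (@filterS _ F) FB => b Bb; exists b.
have xO : nbhs x O by exact: open_nbhs_nbhs.
have [_ [[b Bb <-] Ob]] := Fx _ _ FB' xO.
by exists b; split=> //; exact: ON.
Qed.

End GeneralTopology.

(** * E*-unitary inverse semigroups *)

Local Open Scope ivs_scope.

(** The equation [e * s = e] is the natural partial order [e <= s]. *)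
Definition e_star_unitary (T : inv_semigroup) := forall e s : T,
  is_proj e -> e <> 0 -> e * s = e -> is_proj s.

Lemma e_star_unitary_germ (T : inv_semigroup) (e s t : T) :
  e_star_unitary T -> is_proj e -> e * (s * s^*) <> 0 -> e * s = e * t ->
  s * s^* * (t * t^*) * s = s * s^* * (t * t^*) * t.
Proof.
move=> uT He es0 es; pose h := s^* * t; pose k := s^* * e * s.
have Pk : is_proj k by rewrite /k -{2}(ivs_starK s); exact: proj_conj.
have k0 : k <> 0.
  move=> k0; apply: es0; transitivity (s * k * s^*); last first.
    by rewrite k0 ivs_mul0r ivs_mul0l.
  rewrite /k -{1}(proj_idem (proj_mulstar s)) ivs_mulA.
  by rewrite (projC He (proj_mulstar s)) !ivs_mulA.
have kh : k * h = k.
  transitivity (s^* * (e * (s * s^*)) * t).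
    by rewrite /k /h !ivs_mulA.
  rewrite (projC He (proj_mulstar s)) -!ivs_mulA -es.
  by rewrite /k !ivs_mulA regularV.
have Ph := uT _ _ Pk k0 kh.
have hE : t^* * s = h by rewrite -(proj_star Ph) ivs_starM ivs_starK.
set f := s * s^* * (t * t^*).
have Pf : is_proj f by apply: projM; exact: proj_mulstar.
have ft : f * t = s * h.
  by rewrite /f /h -!ivs_mulA [t * (t^* * t)]ivs_mulA ivs_regular.
have fs : f * s = t * h.
  rewrite /f (projC (proj_mulstar s) (proj_mulstar t)) -!ivs_mulA.
  by rewrite [s * (s^* * s)]ivs_mulA ivs_regular hE.
have fth : f * t * h = f * s by rewrite -ivs_mulA -fs ivs_mulA (proj_idem Pf).
have fsh : f * s * h = f * t by rewrite -ivs_mulA -ft ivs_mulA (proj_idem Pf).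
by rewrite -fsh -fth -[RHS]ivs_mulA (proj_idem Ph).
Qed.

(** * Compactness of the spectrum and invariance of its tight part *)

Section Spectrum.
Variable T : inv_semigroup.
Local Notation E := (E T).
Local Notation Ehat0 := (Ehat0 T).

Lemma continuous_ch (e : E) : continuous (fun x : Ehat0 => ch x e).
Proof.
move=> x.
apply: (@continuous_comp Ehat0 (cube T) bool val (fun x : cube T => x e)).
  exact: initial_continuous.
exact: (@proj_continuous E (fun _ => bool) e).
Qed.

Lemma cvg_cube (F : set_system (cube T)) (x : cube T) : Filter F ->
  (forall e : E, (fun y : cube T => y e) @ F --> x e) -> F --> x.
Proof. by move=> FF Fx; apply/cvg_sup => e; apply: cvg_initial. Qed.

(** Each coordinate is an evaluation at a conjugate [s * e * s^*]. As a map into the whole cube,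
    [act_fun] needs no domain condition. *)
Lemma continuous_act_fun (s : T) : continuous (fun x : Ehat0 => act_fun x s).
Proof.
move=> x; apply: (cvg_cube (fmap_filter _ (nbhs_filter x))) => e.
exact: (@continuous_ch (E_conj s e) x).
Qed.

(** Continuity of the partial action, phrased with domain proofs as arguments rather than on a
    subspace. *)
Lemma nbhs_act (x : Ehat0) s (xs : dom s x) (V : set Ehat0) :
  nbhs (act xs) V -> \forall y \near x, forall ys : dom s y, V (act ys).
Proof.
move=> [_ [[O oO <-] Ox OV]].
have xO : nbhs x [set y : Ehat0 | O (act_fun y s)].
  by apply: continuous_act_fun; exact: open_nbhs_nbhs.
by apply: filterS xO => y Oy ys; exact: OV.
Qed.

Lemma nbhs_coord (x : cube T) (e : E) : \forall y \near x, y e = x e.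
Proof.
have : nbhs (x e) [set x e] by exact: discrete_set1.
by move=> /(@proj_continuous E (fun _ => bool) e x).
Qed.

Lemma E_mul1l (e : E) : E_mul E_one e = e.
Proof. by apply: val_inj; exact: ivs_mul1l. Qed.

(** Each identity involves finitely many coordinates, which are locally constant. Being nonzero is
    not visibly closed, but for a multiplicative map it amounts to the value at [E_one] being
    [true]. *)
Lemma closed_characters : closed (@characters T).
Proof.
move=> x xcl.
have xM e f : x (E_mul e f) = x e && x f.
  have [|y [[_ yM _] [[/= <- <-] <-]]] :=
    xcl [set y | (y e = x e /\ y f = x f) /\ y (E_mul e f) = x (E_mul e f)].
    by do 2?[apply: filterI]; exact: nbhs_coord.
  exact: yM.
have [y [[[e ye] yM y0] [/= y1 y0x]]] :
    @characters T `&` [set y | y E_one = x E_one /\ y E_zero = x E_zero] !=set0.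
  by apply: xcl; apply: filterI; exact: nbhs_coord.
split=> //; last by rewrite -y0x.
exists E_one; rewrite -y1.
by move: ye; rewrite -{1}(E_mul1l e) yM => /andP[].
Qed.

Lemma compact_Ehat0 : compact [set: Ehat0].
Proof.
apply: compact_set_type; apply: (@subclosed_compact _ _ [set: cube T]) => //.
  exact: closed_characters.
have := @tychonoff E (fun _ => bool) (fun _ => [set: bool]).
rewrite (_ : [set f | _] = setT); last by apply/seteqP; split.
apply=> _; exact: bool_compact.
Qed.

Lemma hausdorff_Ehat0 : hausdorff_space Ehat0.
Proof.
apply: (@hausdorff_inj _ (cube T) set_val); first exact: continuous_set_val.
  exact: val_inj.
by apply: hausdorff_product => _; exact: discrete_hausdorff.
Qed.

Lemma closed_dom (s : T) : closed (@dom T s).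
Proof.
by apply: (@closed_comp _ _ (fun x : Ehat0 => ch x (E_ran s)) [set true]) => [x _|];
  [exact: continuous_ch|exact: discrete_closed].
Qed.

Lemma is_filter_ch (x : Ehat0) : is_filter [set e | ch x e = true].
Proof.
split=> /=.
- by exists E_one; exact: ch1.
- by rewrite ch0.
- by move=> e f xe ef; move: xe; rewrite -ef chM => /andP[].
- by move=> e f; rewrite chM => -> ->.
Qed.

Lemma filter_ch (A : set E) : is_filter A ->
  exists x : Ehat0, A = [set e | ch x e = true].
Proof.
move=> [A0 An0 Aup AM].
have Achar : @characters T (fun e => `[< A e >]).
  split.
  - by have [e Ae] := A0; exists e; apply/asboolP.
  - move=> e f; apply/asboolP/andP => [Aef|[/asboolP Ae /asboolP Af]].
      split; apply/asboolP; apply: Aup Aef _; apply: val_inj => /=.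
        by rewrite ivs_mulA (proj_idem (E_proj e)).
      by rewrite (projC (E_proj e) (E_proj f)) ivs_mulA (proj_idem (E_proj f)).
    exact: AM.
  - by apply/asboolP.
exists (exist (fun x : cube T => x \in @characters T) _ (mem_set Achar)).
by apply/seteqP; split => e; rewrite /ch /= => /asboolP.
Qed.

(** Filters are exactly the supports of characters, so ultrafilters correspond to characters that
    are maximal pointwise. *)
Lemma Ehat_inftyP (x : Ehat0) : @Ehat_infty T x <->
  forall y, (forall e, ch x e = true -> ch y e = true) -> y = x.
Proof.
split=> [[_ xmax] y xy|xmax].
  apply: Ehat0_eq => e.
  have := xmax _ (is_filter_ch y) xy.
  by move=> /seteqP[/(_ e) /= yx /(_ e) /= {}xy]; apply/idP/idP.
split; first exact: is_filter_ch.
by move=> _ /filter_ch[y ->] /xmax ->.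
Qed.

Lemma act_mono (x y : Ehat0) s (xs : dom s x) (ys : dom s y) :
  (forall e, ch x e = true -> ch y e = true) ->
  forall e, ch (act xs) e = true -> ch (act ys) e = true.
Proof. by move=> xy e; exact: xy. Qed.

Lemma dom_act_star (x : Ehat0) s (xs : dom s x) : dom s^* (act xs).
Proof. by have := dom_star (mkS xs); rewrite target_mkS. Qed.

Lemma act_starK (x : Ehat0) s (xs : dom s x) (xss : dom s^* (act xs)) : act xss = x.
Proof.
rewrite -[RHS]/(pt (mkS xs)) -(target_inv (mkS xs)).
exact: Ehat0_eq.
Qed.

(** If [w] dominates [act xs], then [s^*] acts on [w], and the result dominates [x], hence equals
    [x]; acting back by [s] returns [w]. *)
Lemma Ehat_infty_act (x : Ehat0) s (xs : dom s x) :
  @Ehat_infty T x -> @Ehat_infty T (act xs).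
Proof.
move=> /Ehat_inftyP xmax; apply/Ehat_inftyP => w xw.
have xss := dom_act_star xs.
have ws : dom s^* w by exact: xw.
have wx : act ws = x.
  apply: xmax; rewrite -{1}(act_starK xss); exact: act_mono.
have wss : dom s^*^* (act ws) by exact: dom_act_star.
(* The action back is by [s^*^*]; it is compared with that of [s] coordinatewise, since [act]
   depends on a domain proof. *)
rewrite -(act_starK wss); apply: Ehat0_eq => e.
by rewrite /ch /= /act_fun wx; congr (ch x _); apply: val_inj; rewrite /= ivs_starK.
Qed.

Lemma Ehat_tight_act (x : Ehat0) s (xs : dom s x) :
  @Ehat_tight T x -> @Ehat_tight T (act xs).
Proof.
move=> xT V /nbhs_act Vx.
have : nbhs x (dom s) by apply: open_nbhs_nbhs; split; first exact: open_dom.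
move=> /(filterI Vx)/xT[y [yinf [yV ys]]].
by exists (act ys); split; [exact: Ehat_infty_act|exact: yV].
Qed.

Lemma compact_Ehat_tight : compact (@Ehat_tight T).
Proof.
apply: (subclosed_compact _ compact_Ehat0); last exact: subsetT.
exact: closed_closure.
Qed.

End Spectrum.

(** * Topology of the groupoid of germs *)

Section GermTopology.
Variable T : inv_semigroup.
Local Notation Ehat0 := (Ehat0 T).
Local Notation germ := (germ T).
Implicit Types a b : Sigma T.

(** Near [cl a] every germ is a germ of [elt a] itself, so neighbourhoods of germs are read off in
    the spectrum. The continuity proofs for the structure maps rest on this. *)
Lemma nbhs_cl a (O : set germ) : nbhs (cl a) O <->
  \forall x \near pt a, forall xs : dom (elt a) x, O (cl (mkS xs)).
Proof.
split=> [[P [/open_germ[D Dbasis ->] [B DB Ba] DO]]|aO].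
  have [U [t [oU Ut BE]]] := Dbasis _ DB; subst B.
  case: Ba => b [Ub bt /clP[ab [e [ae es]]]].
  (* On this smaller set the witness [e] takes the value 1, so [t] and [elt a] have the same germs
     there. *)
  have : open_nbhs (pt a) (U `&` [set x | ch x e = true]).
    by split; [apply: openI => //; exact: open_ch|rewrite ab; split => //=;
       rewrite -ab].
  move=> /open_nbhs_nbhs; apply: filterS => x [Ux xe] xs.
  apply: DO; exists (Theta U t) => //.
  exists (mkS (Ut _ Ux)); split=> //; apply/clP; split=> //.
  by exists e; split => //; rewrite /elt /= -/(elt a) es bt.
have aa : nbhs (pt a) (dom (elt a)).
  by apply: open_nbhs_nbhs; split; [exact: open_dom|exact: SigmaP].
have : nbhs (pt a) (dom (elt a) `&`
    [set x | forall xs : dom (elt a) x, O (cl (mkS xs))]) by exact: filterI.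
rewrite nbhsE => -[U [oU aU] UO].
exists (Theta U (elt a)); split.
- apply/open_germ; exists [set Theta U (elt a)]; last by rewrite bigcup_set1.
  by move=> _ ->; exists U, (elt a); split=> // x /UO[].
- by exists a.
move=> _ [b [/UO[bs bO] ba ->]].
by have <- : cl (mkS bs) = cl b by exact: cl_eq.
Qed.

Lemma nbhs_Theta a U : nbhs (pt a) U -> nbhs (cl a) (Theta U (elt a)).
Proof.
by move=> aU; apply/nbhs_cl; apply: filterS aU => x Ux xs; exists (mkS xs).
Qed.

Lemma open_Theta U s : open U -> open (Theta U s : set germ).
Proof.
move=> oU; rewrite openE => _ [a [Ua <- ->]].
by apply: nbhs_Theta; exact: open_nbhs_nbhs.
Qed.

Lemma continuous_germ_rng : continuous (@germ_rng T).
Proof.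
elim/germ_ind => a V; rewrite germ_rng_cl => aV; apply/nbhs_cl.
by apply: filterS aV => x Vx xs; rewrite /= germ_rng_cl.
Qed.

Lemma continuous_germ_src : continuous (@germ_src T).
Proof.
elim/germ_ind => a V; rewrite germ_src_cl => /nbhs_act aV; apply/nbhs_cl.
by apply: filterS aV => x Vx xs; rewrite /= germ_src_cl target_mkS.
Qed.

Lemma continuous_germ_idt : continuous (@germ_idt T).
Proof. by move=> x V /nbhs_cl; apply: filterS => y; exact. Qed.

Lemma continuous_germ_inv : continuous (@germ_inv T).
Proof.
elim/germ_ind => a V; rewrite germ_inv_cl => /nbhs_cl/nbhs_act aV.
apply/nbhs_cl; apply: filterS aV => x Vx xs; rewrite /= germ_inv_cl.
have -> : cl (mkS (dom_star (mkS xs))) = cl (mkS (dom_act_star xs)).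
  by apply: cl_eq => //; exact: target_mkS.
exact: Vx.
Qed.

Lemma continuous_germ_mul :
  {within [set gh : germ * germ | germ_src gh.1 = germ_rng gh.2],
    continuous (fun gh => germ_mul gh.1 gh.2)}.
Proof.
apply/subspace_continuousP => -[g h] /=.
elim/germ_ind: g => a; elim/germ_ind: h => b.
rewrite germ_src_cl germ_rng_cl => ab V /=.
rewrite {1}/from_subspace /= (germ_mul_cl ab) => /nbhs_cl aV.
(* Only the first factor is constrained: a product has the base point of its first factor. *)
exists (Theta [set x | forall xs : dom (elt a * elt b) x, V (cl (mkS xs))] (elt a),
        Theta setT (elt b)) => /=.
  by split; apply: nbhs_Theta; [exact: aV|exact: filterT].
move=> [_ _] /= [[c [cV ca ->]] [d [_ db ->]]].
rewrite germ_src_cl germ_rng_cl => cd.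
rewrite /from_subspace /= (germ_mul_cl cd).
have cdab : dom (elt a * elt b) (pt c) by rewrite -ca -db; exact: dom_mul.
have -> : cl (mkS (dom_mul cd)) = cl (mkS cdab).
  by apply: cl_eq => //; rewrite /elt /= -/(elt c) -/(elt d) ca db.
exact: cV.
Qed.

Lemma germ_topological_groupoid : is_topological_groupoid (germ_groupoid T).
Proof.
split.
- exact: continuous_germ_rng.
- exact: continuous_germ_src.
- exact: continuous_germ_idt.
- exact: continuous_germ_inv.
- exact: continuous_germ_mul.
Qed.

(** Inseparable germs have the same range because the spectrum is Hausdorff. Their neighbourhoods
    [Theta setT _] share a germ, so the two semigroup elements agree under a nonzero projection,
    hence under the product of their range projections, which has value 1 at the common range. *)
Lemma hausdorff_germ : e_star_unitary T -> hausdorff_space germ.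
Proof.
move=> uT g h gh.
have : germ_rng g = germ_rng h.
  apply: hausdorff_Ehat0 => A B /continuous_germ_rng Ag /continuous_germ_rng Bh.
  by have [x [? ?]] := gh _ _ Ag Bh; exists (germ_rng x).
move: gh; elim/germ_ind: g => a; elim/germ_ind: h => b.
rewrite !germ_rng_cl => gh ab.
have [_ [[c [_ ca ->]] [d [_ db /clP[_ [e [ce es]]]]]]] :=
  gh _ _ (nbhs_Theta filterT) (nbhs_Theta filterT).
apply/clP; split=> //; exists (E_mul (E_ran (elt a)) (E_ran (elt b))); split.
  by rewrite chM (SigmaP a : ch _ _ = _) ab (SigmaP b : ch _ _ = _).
apply: (@e_star_unitary_germ T (val e)) => //; first exact: E_proj.
  (* The projection is nonzero because the character [pt c] takes the value 1 on it. *)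
  move=> e0; have := SigmaP c; rewrite /dom /= => cc.
  have : ch (pt c) (E_mul e (E_ran (elt c))) = true by rewrite chM ce cc.
  suff -> : E_mul e (E_ran (elt c)) = E_zero by rewrite ch0.
  by apply: val_inj; rewrite /= ca.
by rewrite -ca -db.
Qed.

End GermTopology.

(** * Reductions of topological groupoids *)

Lemma reduction_topological (G : groupoid) (X : set (obj G)) :
  is_topological_groupoid G -> is_topological_groupoid (reduction X).
Proof.
move=> [rngC srcC idtC invC mulC]; split.
- apply: continuous_into_set_type => x.
  apply: (@continuous_comp _ _ _ (set_val : red_arr X -> arr G) (@rng G)).
    exact: continuous_set_val.
  exact: rngC.
- apply: continuous_into_set_type => x.
  apply: (@continuous_comp _ _ _ (set_val : red_arr X -> arr G) (@src G)).
    exact: continuous_set_val.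
  exact: srcC.
- apply: continuous_into_set_type => x.
  apply: (@continuous_comp _ _ _ (set_val : red_obj X -> obj G) (@idt G)).
    exact: continuous_set_val.
  exact: idtC.
- apply: continuous_into_set_type => x.
  apply: (@continuous_comp _ _ _ (set_val : red_arr X -> arr G) (@ginv G)).
    exact: continuous_set_val.
  exact: invC.
apply/subspace_continuousP => -[g h] /= /red_composable gh.
move=> V [_ [[O oO <-] Ogh OV]].
have {}Ogh : O (gmul (val g) (val h)) by rewrite -(val_red_mul gh).
move/subspace_continuousP: mulC => /(_ (val g, val h) gh O) /=.
case; first by apply: open_nbhs_nbhs; split.
move=> [A B] /= [gA hB] AB.
exists (set_val @^-1` A, set_val @^-1` B) => /=.
  by split; apply: continuous_set_val.
move=> [g' h'] /= [Ag Bh] /red_composable gh'; apply: OV => /=.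
by rewrite [set_val _]val_red_mul //; exact: (AB (val g', val h')).
Qed.

(** * Local sections of the range map of the tight groupoid *)

Section TightGroupoid.
Variable T : inv_semigroup.
Local Notation Ehat0 := (Ehat0 T).
Local Notation G := (tight_groupoid T).

Definition tight_dom (s : T) : set (obj G) := [set x | dom s (val x)].
Definition tight_Theta (s : T) : set (arr G) :=
  [set g | Theta (@dom T s) s (val g)].

(** Invariance of the tight spectrum makes the source tight as soon as the range is. *)
Lemma red_arrows_cl (x : obj G) s (xs : dom s (val x)) :
  red_arrows (G := germ_groupoid T) (@Ehat_tight T) (cl (mkS xs)).
Proof.
split; rewrite /= ?germ_rng_cl ?germ_src_cl ?target_mkS; first exact: set_valP.
by apply: Ehat_tight_act; exact: set_valP.
Qed.

(* [x |-> [(x, s)]], with junk value [g0] outside the domain of [s] *)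
Definition tight_section (g0 : arr G) (s : T) (x : obj G) : arr G :=
  if pselect (dom s (val x)) is left xs then mk_arr (red_arrows_cl xs) else g0.

Lemma val_tight_section g0 s (x : obj G) (xs : dom s (val x)) :
  val (tight_section g0 s x) = cl (mkS xs).
Proof.
by rewrite /tight_section; case: pselect => // xs'; exact: cl_eq.
Qed.

Lemma rng_tight_section g0 s (x : obj G) : tight_dom s x ->
  rng (tight_section g0 s x) = x.
Proof.
by move=> xs; apply: val_inj; rewrite /= (val_tight_section _ xs) germ_rng_cl.
Qed.

Lemma tight_Theta_section g0 s (x : obj G) : tight_dom s x ->
  tight_Theta s (tight_section g0 s x).
Proof.
move=> xs; rewrite /tight_Theta /= (val_tight_section _ xs).
by exists (mkS xs).
Qed.

Lemma tight_dom_rng s (g : arr G) : tight_Theta s g -> tight_dom s (rng g).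
Proof. by move=> [a [asd _ ga]]; rewrite /tight_dom /= ga germ_rng_cl. Qed.

Lemma tight_section_rng g0 s (g : arr G) : tight_Theta s g ->
  tight_section g0 s (rng g) = g.
Proof.
move=> gs; apply: val_inj; rewrite (val_tight_section _ (tight_dom_rng gs)).
have [a [_ as_ ga]] := gs.
by rewrite [RHS]ga; apply: cl_eq => //; rewrite /pt /= ga germ_rng_cl.
Qed.

Lemma image_tight_Theta s : @rng G @` tight_Theta s = tight_dom s.
Proof.
apply/seteqP; split => [_ [g gs <-]|x xs]; first exact: tight_dom_rng.
(* Any arrow will do as the junk value, since [x] lies in the domain of [s]. *)
have g0 : arr G := idt x.
exists (tight_section g0 s x); last exact: rng_tight_section.
exact: tight_Theta_section.
Qed.

Lemma open_tight_dom s : open (tight_dom s).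
Proof. by exists (dom s) => //; exact: open_dom. Qed.

Lemma open_tight_Theta s : open (tight_Theta s).
Proof.
by exists (Theta (@dom T s) s) => //; apply: open_Theta; exact: open_dom.
Qed.

Lemma continuous_tight_section g0 s :
  {within tight_dom s, continuous (tight_section g0 s)}.
Proof.
apply/subspace_continuousP => x xs V [_ [[O oO <-] Ox OV]].
have : nbhs (cl (mkS xs)) O.
  by apply: open_nbhs_nbhs; split => //; rewrite -(val_tight_section g0).
move=> /nbhs_cl xO.
have xO' : nbhs x [set y : obj G | forall ys : dom s (val y), O (cl (mkS ys))].
  exact: (@continuous_set_val _ _ x _ xO).
apply: filterS xO' => y yO ys; apply: OV.
by have := yO ys; rewrite -(val_tight_section g0).
Qed.

Lemma compact_tight_Theta s : compact (tight_Theta s).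
Proof.
(* The empty case is separate because the section needs a default arrow. *)
have [->|/set0P[g0 g0s]] := eqVneq (tight_Theta s) set0; first exact: compact0.
have -> : tight_Theta s = tight_section g0 s @` tight_dom s.
  apply/seteqP; split=> [g gs|_ [x xs <-]]; last exact: tight_Theta_section.
  by exists (rng g); [exact: tight_dom_rng|exact: tight_section_rng].
apply: continuous_compact; first exact: continuous_tight_section.
(* The domain of [s] is clopen, so its trace on the compact tight spectrum is compact. *)
apply: (@subclosed_compact _ _ [set: obj G]) => //.
  apply: (@closed_comp _ _ (set_val : obj G -> Ehat0) (dom s)) => [x _|].
    exact: continuous_set_val.
  exact: closed_dom.
by apply: compact_set_type; exact: compact_Ehat_tight.
Qed.

Lemma tight_Theta_self (g : arr G) : tight_Theta (elt (repr (val g))) g.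
Proof.
exists (repr (val g)); split => //; [exact: SigmaP|exact: germE].
Qed.

Lemma is_etale_tight_groupoid : e_star_unitary T -> is_etale G.
Proof.
move=> uT.
have hG : hausdorff_space (arr G).
  apply: (@hausdorff_inj _ (germ T) set_val); first exact: continuous_set_val.
    exact: val_inj.
  exact: hausdorff_germ.
have topG : is_topological_groupoid G.
  by apply: reduction_topological; exact: germ_topological_groupoid.
split.
  (* The same set [tight_Theta s] serves as the compact neighbourhood here and as the local
     homeomorphism's domain below; it is closed since the space is Hausdorff. *)
  split=> // g _; exists (tight_Theta (elt (repr (val g)))).
    apply: filterS (open_nbhs_nbhs (conj (open_tight_Theta _) (tight_Theta_self g))).
    by [].
  by split; [|apply: compact_closed => //]; exact: compact_tight_Theta.
move=> g; set s := elt (repr (val g)).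
exists (tight_Theta s); split.
- exact: open_tight_Theta.
- exact: tight_Theta_self.
- by rewrite image_tight_Theta; exact: open_tight_dom.
exists (tight_section g s); split.
- by move=> h; exact: tight_section_rng.
- by case: topG => rngC _ _ _ _; exact: continuous_subspaceT.
- by rewrite image_tight_Theta; exact: continuous_tight_section.
Qed.

End TightGroupoid.

(** * Fixed points of the partial bijections in T *)

(** Wherever it is defined, [sig b n m] translates by [m - n]. *)
Lemma sig_fixpoint b n m k : sig b n m k = Some k -> n = m.
Proof. by rewrite /sig; case: b; case: ifP => // ? [?]; lia. Qed.

Lemma sig_diag b n k l : sig b n n k = Some l -> k = l.
Proof. by rewrite /sig; case: b; case: ifP => // ? [?]; lia. Qed.

Lemma big_fixpoint b1 n1 m1 b2 n2 m2 r x :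
  big b1 n1 m1 b2 n2 m2 r x = Some x -> [/\ n1 = m1, n2 = m2 & r = 0%R].
Proof.
case: x => [[i j] k]; rewrite /big /ptensor /=.
case E1: (sig b1 n1 m1 i) => [i'|] //=; case E2: (sig b2 n2 m2 j) => [j'|] //=.
move=> [ii jj kr]; rewrite ii in E1; rewrite jj in E2; split.
- exact: sig_fixpoint E1.
- exact: sig_fixpoint E2.
- lia.
Qed.

Lemma big_diag b1 n1 b2 n2 x y : big b1 n1 n1 b2 n2 n2 0%R x = Some y -> x = y.
Proof.
case: x => [[i j] k]; rewrite /big /ptensor /=.
case E1: (sig b1 n1 n1 i) => [i'|] //=; case E2: (sig b2 n2 n2 j) => [j'|] //=.
by move=> [<-]; rewrite (sig_diag E1) (sig_diag E2) GRing.addr0.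
Qed.

Lemma diag_pinv (I : Type) (phi : I -> option I) :
  (forall x y, phi x = Some y -> x = y) -> Defs.pinv phi phi.
Proof. by move=> diag x y; split=> E; move: (E); rewrite (diag _ _ E). Qed.

Lemma T_e_star_unitary (R : realType) : e_star_unitary (T_semigroup R).
Proof.
move=> e s [ee es] e0 ess.
have [phi [Hphi [eE diag]]] := T_proj_diag ee es.
(* The nonzero projection [e] is given by a partial identity with nonempty domain. *)
have [i phii] : exists i, phi i = Some i.
  apply: contrapT => /forallNP none; apply: e0; apply: val_inj.
  rewrite /= eE zeroE; apply: pullback_ext => i.
  by case E: (phi i) => [j|] //; case: (none i); rewrite E (diag _ _ E).
have /in_TP[s0|[b1 [n1 [m1 [b2 [n2 [m2 [r [_ sE]]]]]]]]] := T_P s.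
  case: e0; have s0' : s = 0 by exact: val_inj.
  by rewrite -ess s0' ivs_mul0r.
(* Evaluating [e * s = e] at [i] makes [i] a fixed point of the partial bijection of [s]. *)
have bi : big b1 n1 m1 b2 n2 m2 r i = Some i.
  move: (congr1 val ess); rewrite val_T_mul eE sE pullback_comp.
  by move=> /pullback_inj/(congr1 (@^~ i)); rewrite /Defs.pcomp phii.
have [n1m1 n2m2 r0] := big_fixpoint bi.
(* Now [s] is given by a partial identity, which is idempotent and its own partial inverse. *)
subst m1 m2 r; split; apply: val_inj.
  rewrite val_T_mul sE pullback_comp; apply: pullback_ext => x.
  rewrite /Defs.pcomp; case E: (big _ _ _ _ _ _ _ x) => [y|] //=.
  by rewrite -{1}(big_diag E).
by rewrite val_T_star sE; apply: adj_pullback; apply: diag_pinv; exact: big_diag.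
Qed.

Theorem proposition4p5 (R : realType) : is_etale (G_tight R).
Proof. exact: is_etale_tight_groupoid (@T_e_star_unitary R). Qed.
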